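(* Let $G_1=\mathbb{T}\times\mathbb{R}^n\times V_1\times H_1$ and $G_2=\mathbb{T}\times\mathbb{R}^n\times V_2\times H_2$ be translation complete subgroups of $G_{aWH}$. (a) $G_1$ and $G_2$ are conjugate within $G_{aWH}$ if and only if there exists $g\in\mathrm{GL}(n,\mathbb{R})$ such that $(1,0,0,g)^{-1}G_1(1,0,0,g)=G_2$. This equation is equivalent to the equalities $V_2=g^TV_1$ and $H_2=g^{-1}H_1g$ holding simultaneously. (b) Assume that $(1,0,0,g)^{-1}G_1(1,0,0,g)=G_2$. Let $U\subset\widehat{\mathbb{R}^n}$ be a $V_1\rtimes H_1^T$-invariant Borel set. Then $g^TU\subset\widehat{\mathbb{R}^n}$ is $V_2\rtimes H_2^T$-invariant. If $\psi\in\mathcal{H}_U$ is admissible (respectively weakly admissible) for the action of $G_1$ on $\mathcal{H}_U$, then $\pi(1,0,0,g)^{-1}\psi$ has the same property for the action of $G_2$ on $\mathcal{H}_{g^TU}$. The quasi-regular representation of $G_1$ acting on $\mathcal{H}_U$ is a discrete series representation if and only if the quasi-regular representation of $G_2$ acting on $\mathcal{H}_{g^TU}$ is a discrete series representation. (c) Let $G=\mathbb{T}\times\mathbb{R}^n\times V\times H$ be a translation complete subgroup. Then $G$ is conjugate within $G_{aWH}$ to a translation complete subgroup $G'=\mathbb{T}\times\mathbb{R}^n\times(\mathbb{R}^k\times\{0\}^{n-k})\times H'$, where $k=\dim(V)$ and $H'<\mathrm{GL}(n,\mathbb{R})$ is suitably chosen.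
   Context: The dual group $\widehat{\mathbb{R}^n}$ is identified with $\mathbb{R}^n$ (column vectors) by associating to $\xi$ the character $x\mapsto e^{2\pi i\langle x,\xi\rangle}$; $\widehat f(\gamma)=\int f(x)e^{-2\pi i\langle\gamma,x\rangle}dx$. The affine Weyl-Heisenberg group is $G_{aWH}=\mathbb{T}\times\mathbb{R}^n\times\widehat{\mathbb{R}^n}\times\mathrm{GL}(n,\mathbb{R})$ with the product topology and group law $(z_1,x_1,\xi_1,h_1)(z_2,x_2,\xi_2,h_2)=(z_1z_2e^{2\pi i\langle\xi_1,h_1x_2\rangle},\,x_1+h_1x_2,\,\xi_1+h_1^{-T}\xi_2,\,h_1h_2)$, where $h^{-T}=(h^{-1})^T$. Its quasi-regular representation on $L^2(\mathbb{R}^n)$ is $\pi(z,x,\xi,h)=zT_xM_\xi D_h$, where $T_xf(y)=f(y-x)$, $M_\xi f(y)=e^{2\pi i\langle y,\xi\rangle}f(y)$, $D_hf(y)=|\det h|^{-1/2}f(h^{-1}y)$. A translation complete subgroup is a subgroup $G=\mathbb{T}\times\mathbb{R}^n\times V\times H$, where $V\subset\widehat{\mathbb{R}^n}$ is a linear subspace, $H$ is a closed subgroup of $\mathrm{GL}(n,\mathbb{R})$, and $h^TV\subset V$ for all $h\in H$; $L^2(G)$ is taken with respect to left Haar measure. Two subgroups $G_1,G_2$ of $G_{aWH}$ are conjugate within $G_{aWH}$ if there is $x\in G_{aWH}$ with $x^{-1}G_1x=G_2$. The group $V\rtimes H^T$ is the set $V\times H$ with law $(\xi_1,h_1)(\xi_2,h_2)=(\xi_1+h_1^{-T}\xi_2,h_1h_2)$;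 it acts on $\widehat{\mathbb{R}^n}$ from the right by the dual action $\gamma.(\xi,h)=h^T(\gamma-\xi)$. For a Borel set $U\subset\widehat{\mathbb{R}^n}$, $\mathcal{H}_U=\{f\in L^2(\mathbb{R}^n):\widehat f=0\text{ a.e. outside }U\}$. For $G$-invariant $\mathcal{H}_U$ and $\psi\in\mathcal{H}_U$ let $V_\psi f(\mathbf{x})=\langle f,\pi(\mathbf{x})\psi\rangle$, $\mathbf{x}\in G$; $\psi$ is weakly admissible if $V_\psi:\mathcal{H}_U\to L^2(G)$ is bounded and injective, and admissible if $V_\psi:\mathcal{H}_U\to L^2(G)$ is a nonzero scalar multiple of an isometry. The representation $\pi|_G$ on $\mathcal{H}_U$ is a discrete series representation if it is irreducible and an admissible vector for $\mathcal{H}_U$ exists. *)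

(* Defs.v *)
From HB Require Import structures.
From mathcomp Require Import all_boot all_order all_algebra complex.
From mathcomp Require Import all_classical all_reals all_analysis.
From mathcomp Require Import ring.

Set Implicit Arguments.
Unset Strict Implicit.
Unset Printing Implicit Defensive.
Import Order.TTheory GRing.Theory Num.Theory numFieldNormedType.Exports.

Local Open Scope classical_set_scope.
Local Open Scope ring_scope.
Local Open Scope complex_scope.

HB.instance Definition _ (R : realType) := Topological.copy R[i] R[i]^o.

Notation borel T := (g_sigma_algebraType (@open T)).

(* The image measure with its measure structure: the library instance cannot
   infer the measurability proof. *)
Definition pushforward_measure d1 d2 (T1 : measurableType d1)
    (T2 : measurableType d2) (R : realType) (m : {measure set T1 -> \bar R})
    (f : T1 -> T2) (mf : measurable_fun setT f) : {measure set T2 -> \bar R} :=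
  measure_function_pushforward__canonical__measure_function_Measure m mf.

Section lebesgue_Rn.
Context (R : realType).
Local Notation rtuple n := (n.-tuple (measurableTypeR R)).

Definition cons_pair n (p : rtuple n * measurableTypeR R) : rtuple n.+1 :=
  [the rtuple n.+1 of p.2 :: p.1].

Lemma measurable_cons_pair n : measurable_fun setT (@cons_pair n).
Proof. exact: measurable_cons. Qed.

Fixpoint lebesgue_tuple n : {measure set (rtuple n) -> \bar R} :=
  match n return {measure set (rtuple n) -> \bar R} with
  | 0 => \d_ ([tuple] : rtuple 0)
  | m.+1 => pushforward_measure (lebesgue_tuple m \x @lebesgue_measure R)%E
                        (@measurable_cons_pair m)
  end.

Definition col_of_tuple n (t : rtuple n) : borel 'cV[R]_n :=
  \col_i tnth t i.

Lemma measurable_col_of_tuple n : measurable_fun setT (@col_of_tuple n).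
Proof.
apply: (@measurability _ _ _ (borel 'cV[R]_n) _ _ (@open 'cV[R]_n)) => //.
move=> _ [A oA <-]; rewrite setTI.
pose box (q : {ffun 'I_n -> rat * rat}) : set (rtuple n) :=
  [set t | forall i, ratr (q i).1 < tnth t i < ratr (q i).2].
pose F q : set (rtuple n) :=
  if `[< box q `<=` @col_of_tuple n @^-1` A >] then box q else set0.
have -> : @col_of_tuple n @^-1` A = \bigcup_q F q.
  apply/seteqP; split=> [t At|t [q _]]; last first.
    by rewrite /F; case: asboolP => // + bt; exact.
  have [P nP sP] : nbhs (col_of_tuple t) A by exact: open_nbhs_nbhs.
  have H i : exists q : rat * rat, ratr q.1 < tnth t i < ratr q.2 /\
      (forall x : R, ratr q.1 < x < ratr q.2 -> P i ord0 x).
    have := nP i ord0; rewrite mxE => /nbhs_ballP[e /= e0 eP].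
    have [q1 /itvP q1P] : exists q, ratr q \in `]tnth t i - e, tnth t i[%R.
      by apply: rat_in_itvoo; rewrite ltrBlDr ltrDl.
    have [q2 /itvP q2P] : exists q, ratr q \in `]tnth t i, tnth t i + e[%R.
      by apply: rat_in_itvoo; rewrite ltrDl.
    exists (q1, q2) => /=; split; first by rewrite q1P q2P.
    move=> x /andP[x1 x2]; apply: eP; rewrite /ball/= ltr_distlC.
    by rewrite (lt_trans _ x1) ?q1P//= (lt_trans x2) ?q2P.
  have [q Hq] := choice H.
  exists [ffun i => q i] => //; rewrite /F; case: asboolP => [_ i|[]].
    by rewrite ffunE; case: (Hq i).
  move=> s bs; apply: sP => i j; rewrite (ord1 j) mxE.
  by apply: (proj2 (Hq i)); have := bs i; rewrite ffunE.
apply: countable_bigcupT_measurable; first exact: countableP.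
move=> q; rewrite /F; case: asboolP => // _.
have -> : box q = \bigcap_(i in [set: 'I_n])
    ((@tnth _ _ ^~ i) @^-1` `]ratr (q i).1, ratr (q i).2[%classic).
  apply/seteqP; split => t bt i; [move=> _ | ]; have := bt i.
    by rewrite /= in_itv.
  by move=> /(_ I); rewrite /= in_itv.
apply: fin_bigcap_measurable; first exact: finite_finset.
move=> i _; rewrite -[X in measurable X]setTI.
exact: measurable_tnth.
Qed.

(* Lebesgue measure on the Borel sigma-algebra of R^n, as the n-fold product of
   the one-dimensional one. *)
Definition lebesgue_Rn n : {measure set (borel 'cV[R]_n) -> \bar R} :=
  pushforward_measure (lebesgue_tuple n) (@measurable_col_of_tuple n).

End lebesgue_Rn.

Section L2.
Context d (T : measurableType d) (R : realType).
Implicit Types (mu : {measure set T -> \bar R}) (f g : T -> R[i]).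

Definition cmeasurable f : Prop :=
  measurable_fun setT (fun x => complex.Re (f x) : measurableTypeR R) /\
  measurable_fun setT (fun x => complex.Im (f x) : measurableTypeR R).

(* Lebesgue integral of a complex-valued function *)
Definition cintegral mu f : R[i] :=
  (\int[mu]_x complex.Re (f x))%R +i* (\int[mu]_x complex.Im (f x))%R.

Definition cLnorm mu (p : \bar R) f : \bar R :=
  Lnorm mu p (fun x => (ComplexField.Normc.normc (f x))%:E).

(* Elements of L^p are represented by functions; identification up to
   mu-almost everywhere equality is made explicit wherever it matters. *)
Definition Lp mu (p : \bar R) : set (T -> R[i]) :=
  [set f | cmeasurable f /\ (cLnorm mu p f < +oo)%E].

Definition inner mu f g : R[i] := cintegral mu (fun x => f x * (g x)^*).

Definition cvg_Lp mu (p : \bar R) (u : nat -> T -> R[i]) f : Prop :=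
  cLnorm mu p (fun x => u k x - f x) @[k --> \oo] --> 0%E.

Definition closed_subspace mu (K : set (T -> R[i])) : Prop :=
  [/\ K `<=` Lp mu 2%:E,
      K (fun=> 0),
      forall (a : R[i]) f g, K f -> K g -> K (fun x => a * f x + g x) &
      forall u f, (forall k, K (u k)) -> Lp mu 2%:E f -> cvg_Lp mu 2%:E u f ->
        K f].

End L2.

Definition is_subgroup (G : groupType) (S : set G) : Prop :=
  [/\ S 1%g, forall x y, S x -> S y -> S (x * y)%g &
      forall x, S x -> S x^-1%g].

Definition conjugate_by (G : groupType) (x : G) (S : set G) : set G :=
  [set (x^-1 * y * x)%g | y in S].

Definition conjugate (G : groupType) (S1 S2 : set G) : Prop :=
  exists x : G, conjugate_by x S1 = S2.

Definition expi (R : realType) (t : R) : R[i] :=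
  cos (2 * pi * t) +i* sin (2 * pi * t).

Section torus.
Context (R : realType).

Definition torus : Type := set_type [set z : R[i] | `|z| = 1].

HB.instance Definition _ := Choice.copy torus
  (set_type [set z : R[i] | `|z| = 1]).
HB.instance Definition _ := Topological.copy torus
  (set_type [set z : R[i] | `|z| = 1]).

Definition torus_val (z : torus) : R[i] := set_val z.

Lemma torus_valP (z : torus) : `|torus_val z| = 1.
Proof. exact: (set_valP z). Qed.

Lemma torus_val_inj : injective torus_val.
Proof. exact: val_inj. Qed.

Definition Torus (z : R[i]) (z1 : `|z| = 1) : torus := exist _ z (mem_set z1).

Definition torus_one : torus := Torus (@normr1 R[i]).

Lemma torus_mul_subproof (z w : torus) : `|torus_val z * torus_val w| = 1.
Proof. by rewrite normrM !torus_valP mulr1. Qed.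
Definition torus_mul z w : torus := Torus (torus_mul_subproof z w).

Lemma torus_inv_subproof (z : torus) : `|(torus_val z)^-1| = 1.
Proof. by rewrite normfV torus_valP invr1. Qed.
Definition torus_inv z : torus := Torus (torus_inv_subproof z).

Let torus_neq0 (z : torus) : torus_val z != 0.
Proof. by rewrite -normr_gt0 torus_valP ltr01. Qed.

Lemma torus_mulA : associative torus_mul.
Proof. by move=> x y z; apply: torus_val_inj; exact: mulrA. Qed.
Lemma torus_mul1 : left_id torus_one torus_mul.
Proof. by move=> x; apply: torus_val_inj; exact: mul1r. Qed.
Lemma torus_mulr1 : right_id torus_one torus_mul.
Proof. by move=> x; apply: torus_val_inj; exact: mulr1. Qed.
Lemma torus_mulV : left_inverse torus_one torus_inv torus_mul.
Proof. by move=> x; apply: torus_val_inj; exact: (mulVf (torus_neq0 x)). Qed.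
Lemma torus_mulrV : right_inverse torus_one torus_inv torus_mul.
Proof. by move=> x; apply: torus_val_inj; exact: (mulfV (torus_neq0 x)). Qed.

HB.instance Definition _ := isGroup.Build torus
  torus_mulA torus_mul1 torus_mulr1 torus_mulV torus_mulrV.

Lemma normr_expi (t : R) : `|expi t| = 1.
Proof. by rewrite normc_def /= cos2Dsin2 sqrtr1. Qed.

Definition torus_expi (t : R) : torus := Torus (normr_expi t).

End torus.

Section GL.
Context (R : realType) (n : nat).

Definition GL : Type := set_type [set h : 'M[R]_n | h \in unitmx].

HB.instance Definition _ := Choice.copy GL
  (set_type [set h : 'M[R]_n | h \in unitmx]).
HB.instance Definition _ := Topological.copy GL
  (set_type [set h : 'M[R]_n | h \in unitmx]).

Definition GL_val (h : GL) : 'M[R]_n := set_val h.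
Coercion GL_val : GL >-> matrix.

Lemma GL_valP (h : GL) : (h : 'M[R]_n) \in unitmx.
Proof. exact: (set_valP h). Qed.

Lemma GL_val_inj : injective GL_val.
Proof. exact: val_inj. Qed.

Definition GLof (h : 'M[R]_n) (uh : h \in unitmx) : GL :=
  exist _ h (mem_set uh).

Definition GL_one : GL := GLof (@unitmx1 R n).

Lemma GL_mul_subproof (g h : GL) : (g : 'M[R]_n) *m h \in unitmx.
Proof. by rewrite unitmx_mul !GL_valP. Qed.
Definition GL_mul g h : GL := GLof (GL_mul_subproof g h).

Lemma GL_inv_subproof (h : GL) : invmx h \in unitmx.
Proof. by rewrite unitmx_inv GL_valP. Qed.
Definition GL_inv h : GL := GLof (GL_inv_subproof h).

Lemma GL_mulA : associative GL_mul.
Proof. by move=> x y z; apply: GL_val_inj; exact: mulmxA. Qed.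
Lemma GL_mul1 : left_id GL_one GL_mul.
Proof. by move=> x; apply: GL_val_inj; exact: mul1mx. Qed.
Lemma GL_mulr1 : right_id GL_one GL_mul.
Proof. by move=> x; apply: GL_val_inj; exact: mulmx1. Qed.
Lemma GL_mulV : left_inverse GL_one GL_inv GL_mul.
Proof. by move=> x; apply: GL_val_inj; exact: (mulVmx (GL_valP x)). Qed.
Lemma GL_mulrV : right_inverse GL_one GL_inv GL_mul.
Proof. by move=> x; apply: GL_val_inj; exact: (mulmxV (GL_valP x)). Qed.

HB.instance Definition _ := isGroup.Build GL
  GL_mulA GL_mul1 GL_mulr1 GL_mulV GL_mulrV.

End GL.

Section affine_Weyl_Heisenberg.
Context (R : realType) (n : nat).
Local Notation V := 'cV[R]_n.

Definition dot (x y : V) : R := \sum_i x i 0 * y i 0.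

Definition invT (h : GL R n) : 'M[R]_n := (h^-1%g : GL R n)^T.

(* (z, x, xi, h); the dual of R^n is identified with R^n. *)
Definition aWH : Type := (torus R * V * V * GL R n)%type.

HB.instance Definition _ := Choice.copy aWH (torus R * V * V * GL R n)%type.
HB.instance Definition _ :=
  Topological.copy aWH (torus R * V * V * GL R n)%type.

Definition AWH (z : torus R) (x xi : V) (h : GL R n) : aWH := (z, x, xi, h).

Definition aWH_one : aWH := AWH 1%g 0 0 1%g.

Definition aWH_mul (a b : aWH) : aWH :=
  let: (z1, x1, xi1, h1) := a in let: (z2, x2, xi2, h2) := b in
  AWH (z1 * z2 * torus_expi (dot xi1 (h1 *m x2)))%g
      (x1 + h1 *m x2) (xi1 + invT h1 *m xi2) (h1 * h2)%g.

Definition aWH_inv (a : aWH) : aWH :=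
  let: (z, x, xi, h) := a in
  AWH (z^-1 * torus_expi (dot xi x))%g (- ((h^-1%g : GL R n) *m x)) (- (h^T *m xi)) h^-1%g.

Let dot_tr (A : 'M[R]_n) x y : dot (A^T *m x) y = dot x (A *m y).
Proof.
suff dotE u v : dot u v = (u^T *m v) 0 0.
  by rewrite !dotE trmx_mul trmxK mulmxA.
by rewrite mxE; apply: eq_bigr => i _; rewrite mxE.
Qed.

Let dotDl x y z : dot (x + y) z = dot x z + dot y z.
Proof. by rewrite -big_split; apply: eq_bigr => i _; rewrite mxE mulrDl. Qed.

Let dotDr x y z : dot z (x + y) = dot z x + dot z y.
Proof. by rewrite -big_split; apply: eq_bigr => i _; rewrite mxE mulrDr. Qed.

Let dotNl x z : dot (- x) z = - dot x z.
Proof. by rewrite -sumrN; apply: eq_bigr => i _; rewrite mxE mulNr. Qed.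

Let dotNr x z : dot z (- x) = - dot z x.
Proof. by rewrite -sumrN; apply: eq_bigr => i _; rewrite mxE mulrN. Qed.

Let dot0l x : dot 0 x = 0.
Proof. by apply: big1 => i _; rewrite mxE mul0r. Qed.

Let dot0r x : dot x 0 = 0.
Proof. by apply: big1 => i _; rewrite mxE mulr0. Qed.

Let eD (s t : R) : (torus_expi s * torus_expi t)%g = torus_expi (s + t).
Proof.
apply: torus_val_inj; change (expi s * expi t = expi (s + t)).
rewrite /expi (mulrDr (2 * pi)) cosD sinD.
by rewrite [LHS]/(_ * _)/= [sin _ * cos _ + _]addrC.
Qed.

Let expiD (s t : R) : expi (s + t) = expi s * expi t.
Proof. by rewrite -[RHS]/(torus_val (torus_expi s * torus_expi t)%g) eD. Qed.

Let dotC x y : dot x y = dot y x.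
Proof. by apply: eq_bigr => i _; rewrite mulrC. Qed.

Let e0 : torus_expi (0 : R) = 1%g.
Proof.
apply: torus_val_inj; change (expi (0 : R) = 1).
by rewrite /expi mulr0 cos0 sin0.
Qed.

Let torusC (z w : torus R) : (z * w = w * z)%g.
Proof. by apply: torus_val_inj; exact: mulrC. Qed.

Let GLVK (h : GL R n) : (h^-1%g : GL R n) *m h = 1%:M.
Proof. exact: (mulVmx (GL_valP h)). Qed.

Let GLKV (h : GL R n) : h *m (h^-1%g : GL R n) = 1%:M.
Proof. exact: (mulmxV (GL_valP h)). Qed.

Let GLM (g h : GL R n) : GL_val (g * h)%g = g *m h.
Proof. by []. Qed.

Lemma aWH_mulA : associative aWH_mul.
Proof.
move=> [[[z1 x1] xi1] h1] [[[z2 x2] xi2] h2] [[[z3 x3] xi3] h3].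
rewrite /aWH_mul /AWH; congr (_, _, _, _).
- rewrite /invT mulmxDr dotDl dotDr dot_tr GLM !mulmxA GLVK mul1mx -!eD.
  rewrite -!mulgA; congr (_ * (_ * _))%g.
  rewrite !mulgA [RHS]torusC !mulgA; congr (_ * _)%g.
  by rewrite -mulgA torusC.
- by rewrite GLM mulmxDr !mulmxA addrA.
- by rewrite /invT invgM GLM trmx_mul mulmxDr !mulmxA addrA.
- by rewrite mulgA.
Qed.
Lemma aWH_mul1 : left_id aWH_one aWH_mul.
Proof.
move=> [[[z x] xi] h]; rewrite /aWH_mul /aWH_one /AWH; congr (_, _, _, _).
- by rewrite dot0l e0 mulg1 mul1g.
- by rewrite mul1mx add0r.
- by rewrite /invT invg1 trmx1 mul1mx add0r.
- by rewrite mul1g.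
Qed.
Lemma aWH_mulr1 : right_id aWH_one aWH_mul.
Proof.
move=> [[[z x] xi] h]; rewrite /aWH_mul /aWH_one /AWH; congr (_, _, _, _).
- by rewrite mulmx0 dot0r e0 !mulg1.
- by rewrite mulmx0 addr0.
- by rewrite mulmx0 addr0.
- by rewrite mulg1.
Qed.
Lemma aWH_mulV : left_inverse aWH_one aWH_inv aWH_mul.
Proof.
move=> [[[z x] xi] h]; rewrite /aWH_mul /aWH_inv /aWH_one /AWH.
congr (_, _, _, _).
- rewrite dotNl dot_tr mulmxA GLKV mul1mx -[(_ * _ * z)%g]mulgA [(_ * z)%g]torusC.
  by rewrite mulgA mulVg mul1g eD subrr e0.
- by rewrite addNr.
- by rewrite /invT invgK addNr.
- by rewrite mulVg.
Qed.
Lemma aWH_mulrV : right_inverse aWH_one aWH_inv aWH_mul.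
Proof. 
move=> [[[z x] xi] h]; rewrite /aWH_mul /aWH_inv /aWH_one /AWH.
congr (_, _, _, _).
- by rewrite mulmxN mulmxA GLKV mul1mx dotNr mulgA mulgV mul1g eD subrr e0.
- by rewrite mulmxN mulmxA GLKV mul1mx subrr.
- by rewrite mulmxN mulmxA /invT -trmx_mul GLKV trmx1 mul1mx subrr.
- by rewrite mulgV.
Qed.

HB.instance Definition _ := isGroup.Build aWH
  aWH_mulA aWH_mul1 aWH_mulr1 aWH_mulV aWH_mulrV.
HB.instance Definition _ := isPointed.Build aWH 1%g.

Definition translation (x : V) (f : V -> R[i]) : V -> R[i] :=
  fun y => f (y - x).
Definition modulation (xi : V) (f : V -> R[i]) : V -> R[i] :=
  fun y => expi (dot y xi) * f y.
Definition dilation (h : GL R n) (f : V -> R[i]) : V -> R[i] :=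
  fun y => ((Num.sqrt `|\det h|)^-1)%:C * f ((h^-1%g : GL R n) *m y).

(* Functions are genuine functions here, so qregM below holds pointwise and
   qreg a^-1 is the inverse operator of qreg a. *)
Definition qreg (a : aWH) (f : V -> R[i]) : V -> R[i] :=
  let: (z, x, xi, h) := a in
  fun y => torus_val z * translation x (modulation xi (dilation h f)) y.

Lemma qreg1 f : qreg 1%g f = f.
Proof.
apply/funext => y; rewrite /= /translation /modulation /dilation invg1.
change (1 * (expi (dot (y - 0) 0) *
  ((Num.sqrt `|\det (1%:M : 'M[R]_n)|)^-1%:C * f (1%:M *m (y - 0)))) = f y).
rewrite det1 normr1 sqrtr1 invr1 dot0r subr0 mul1mx !mul1r.
by rewrite /expi mulr0 cos0 sin0 !mul1r.
Qed.

Lemma qregM a b f : qreg (a * b)%g f = qreg a (qreg b f).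
Proof.
case: a b => [[[z1 x1] xi1] h1] [[[z2 x2] xi2] h2]; apply/funext => y.
rewrite /= /translation /modulation /dilation.
change (torus_val z1 * torus_val z2 * expi (dot xi1 (h1 *m x2)) *
  (expi (dot (y - (x1 + h1 *m x2)) (xi1 + invT h1 *m xi2)) *
   ((Num.sqrt `|\det (h1 *m h2)|)^-1%:C *
    f (GL_val (h1 * h2)^-1%g *m (y - (x1 + h1 *m x2))))) =
  torus_val z1 * (expi (dot (y - x1) xi1) * ((Num.sqrt `|\det h1|)^-1%:C *
   (torus_val z2 * (expi (dot (GL_val h1^-1%g *m (y - x1) - x2) xi2) *
    ((Num.sqrt `|\det h2|)^-1%:C *
     f (GL_val h2^-1%g *m (GL_val h1^-1%g *m (y - x1) - x2)))))))).
have -> : GL_val h1^-1%g *m (y - x1) - x2 =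
    GL_val h1^-1%g *m (y - (x1 + h1 *m x2)).
  by rewrite opprD addrA [RHS]mulmxBr (mulmxA _ h1) GLVK mul1mx.
rewrite invgM GLM -mulmxA; set w := f _.
rewrite det_mulmx normrM sqrtrM// invfM rmorphM/=.
set u := y - (x1 + h1 *m x2).
have -> : expi (dot (y - x1) xi1) =
    expi (dot xi1 (h1 *m x2)) * expi (dot u xi1).
  rewrite -expiD [dot xi1 _]dotC -dotDl /u.
  by rewrite [X in _ = expi (dot X _)]addrC opprD (addrA y) subrK.
have -> : expi (dot u (xi1 + invT h1 *m xi2)) =
    expi (dot u xi1) * expi (dot (GL_val h1^-1%g *m u) xi2).
  by rewrite -expiD dotDr /invT [dot u (_ *m _)]dotC dot_tr [dot xi2 _]dotC.
ring.
Qed.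

(* T x R^n x W x H *)
Definition tc_set (W : {vspace V}) (H : set (GL R n)) : set aWH :=
  [set a | a.1.2 \in W /\ H a.2].

(* [closed H] is relative to the topology of GL(n,R). *)
Definition translation_complete (W : {vspace V}) (H : set (GL R n)) : Prop :=
  [/\ is_subgroup H, closed H,
      forall h : GL R n, H h -> forall v, v \in W -> h^T *m v \in W &
      is_subgroup (tc_set W H)].

Definition dual_act (gamma : V) (xi : V) (h : GL R n) : V :=
  h^T *m (gamma - xi).

Definition dual_invariant (W : {vspace V}) (H : set (GL R n)) (U : set V) :
    Prop :=
  forall gamma xi h, U gamma -> xi \in W -> H h -> U (dual_act gamma xi h).

(* R^k x {0}^(n-k) *)
Definition coord_subspace (k : nat) : {vspace V} :=
  (\sum_(i < n | (i < k)%N) <[delta_mx i 0%R : V]>)%VS.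

Local Notation leb := (lebesgue_Rn R n).

Definition fourier1 (f : V -> R[i]) : V -> R[i] :=
  fun gamma => cintegral leb (fun x => f x * expi (- dot gamma x)).

(* g is (a representative of) the Plancherel transform of f: the extension by
   L^2-continuity of the integral formula on L^1 `&` L^2. *)
Definition is_fourier (f g : V -> R[i]) : Prop :=
  [/\ Lp leb 2%:E f, Lp leb 2%:E g &
      exists u : nat -> V -> R[i],
        [/\ forall k, Lp leb 1%:E (u k) /\ Lp leb 2%:E (u k),
            cvg_Lp leb 2%:E u f &
            cvg_Lp leb 2%:E (fun k => fourier1 (u k)) g]].

(* By Plancherel's theorem g exists and is unique up to a null set. *)
Definition HU (U : set V) : set (V -> R[i]) :=
  [set f | Lp leb 2%:E f /\
     exists2 g, is_fourier f g & {ae leb, forall gamma, ~ U gamma -> g gamma = 0}].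

Definition voice (psi f : V -> R[i]) : aWH -> R[i] :=
  fun a => inner leb f (qreg a psi).

(* A left Haar measure of the closed subgroup G, seen as a Borel measure on the
   ambient group carried by G. The ambient group is second countable and locally
   compact, so finiteness on compact sets already gives regularity. *)
Definition left_haar (G : set aWH) (mu : {measure set (borel aWH) -> \bar R}) :
    Prop :=
  [/\ mu (~` G) = 0%E, mu G != 0%E,
      forall K : set aWH, compact K -> K `<=` G -> (mu K < +oo)%E &
      forall (x : aWH) (A : set (borel aWH)), G x -> measurable A -> A `<=` G ->
        mu [set (x * y)%g | y in (A : set aWH)] = mu A].

(* Left Haar measures are unique up to a positive factor, which affects neither
   boundedness and injectivity nor being a nonzero multiple of an isometry; so
   the choice of mu below is immaterial. *)
Definition weakly_admissible (G : set aWH) (U : set V) (psi : V -> R[i]) :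
    Prop :=
  HU U psi /\
  exists2 mu : {measure set (borel aWH) -> \bar R}, left_haar G mu &
    (exists C : R, forall f, HU U f ->
       Lp mu 2%:E (voice psi f) /\
       (cLnorm mu 2%:E (voice psi f) <= C%:E * cLnorm leb 2%:E f)%E) /\
    (forall f1 f2, HU U f1 -> HU U f2 ->
       {ae mu, forall a, voice psi f1 a = voice psi f2 a} ->
       {ae leb, forall y, f1 y = f2 y}).

Definition isometry_on (K : set (V -> R[i]))
    (mu : {measure set (borel aWH) -> \bar R})
    (W : (V -> R[i]) -> aWH -> R[i]) : Prop :=
  (forall f, K f -> Lp mu 2%:E (W f)) /\
  (forall f1 f2, K f1 -> K f2 ->
     cLnorm mu 2%:E (fun a => W f1 a - W f2 a) =
     cLnorm leb 2%:E (fun y => f1 y - f2 y)).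

Definition admissible (G : set aWH) (U : set V) (psi : V -> R[i]) : Prop :=
  HU U psi /\
  exists2 mu : {measure set (borel aWH) -> \bar R}, left_haar G mu &
    exists (c : R[i]) (W : (V -> R[i]) -> aWH -> R[i]),
      [/\ c != 0, isometry_on (HU U) mu W &
          forall f, HU U f -> forall a, G a -> voice psi f a = c * W f a].

(* The zero representation is not irreducible. *)
Definition irreducible_on (G : set aWH) (E : set (V -> R[i])) : Prop :=
  (exists2 f, E f & ~ {ae leb, forall y, f y = 0}) /\
  (forall K : set (V -> R[i]), closed_subspace leb K -> K `<=` E ->
     (forall a f, G a -> K f -> K (qreg a f)) ->
     (forall f, K f -> {ae leb, forall y, f y = 0}) \/ E `<=` K).

Definition discrete_series (G : set aWH) (U : set V) : Prop :=
  irreducible_on G (HU U) /\ exists psi, admissible G U psi.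

Definition dil (g : GL R n) : aWH := AWH 1%g 0 0 g.

End affine_Weyl_Heisenberg.

(* Main.v *)
From HB Require Import structures.
Require Import Defs.
From mathcomp Require Import all_boot all_order all_algebra complex.
From mathcomp Require Import all_classical all_reals all_analysis.
From mathcomp Require Import measurable_realfun ring.
Import Order.TTheory GRing.Theory Num.Theory numFieldNormedType.Exports.
Set Implicit Arguments.
Unset Strict Implicit.
Unset Printing Implicit Defensive.
Local Open Scope classical_set_scope.
Local Open Scope ring_scope.

(** Conjugation by [dil g] is a homeomorphic automorphism of the ambient group,
    so it carries a left Haar measure of [G1] to one of [G2]; the operator
    [qreg (dil g)^-1] intertwines the two actions and, because [f (g y)] has
    Fourier transform proportional to [f^ (g^-T gamma)], it maps [HU U] onto [HU (g^T U)].
    Admissibility is insensitive to positive scalars, hence it is enough to know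
    that Lebesgue measure is multiplied by some positive constant under an
    invertible matrix, which follows from the uniqueness of
    translation-invariant measures; the constant [|det g|] is never identified.
    If [G1] and [G2] are conjugate by [(z, x, xi, g)], then comparing the
    frequency components of elements with trivial dilation part gives
    [V2 = g^T V1], and the dilation components give [H2 = g^-1 H1 g], so that
    [dil g] conjugates them as well. *)

(** * Monotonicity of the integral for arbitrary nonnegative functions *)

Section nonmeasurable_integral.
Local Open Scope ereal_scope.
Context d (T : measurableType d) (R : realType).
Variable mu : {measure set T -> \bar R}.
Import HBNNSimple.

(** The integral of a nonnegative function is a supremum over the simple functions below it, and a
    larger function has more of them; this covers arbitrary functions. *)
Lemma le_nnintegral (f g : T -> \bar R) :
  (forall x, 0 <= f x) -> (forall x, f x <= g x) ->
  \int[mu]_x f x <= \int[mu]_x g x.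
Proof.
move=> f0 fg.
rewrite !ge0_integralTE//; last by move=> x; exact: le_trans (fg x).
apply: le_ereal_sup => _ [h hf <-]; exists h => // x.
exact: le_trans (fg x).
Qed.

Lemma le_nnintegralP (f : T -> \bar R) (c : \bar R) :
  (forall x, 0 <= f x) ->
  (forall h : {nnsfun T >-> R}, (forall x, (h x)%:E <= f x) ->
    \int[mu]_x (h x)%:E <= c) ->
  \int[mu]_x f x <= c.
Proof.
move=> f0 H; rewrite ge0_integralTE//.
apply: ge_ereal_sup => _ [h hf <-].
by rewrite -integralT_nnsfun; exact: H.
Qed.

End nonmeasurable_integral.

(** * Change of variables along a bijection that scales the measure *)

Section change_of_variables.
Local Open Scope ereal_scope.
Import HBNNSimple.

(** A simple [h] below [f] gives the measurable function k h(phi x) below k f(phi x), and for [h]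
    the formula is the one for image measures. Only one inequality arises, because a simple function
    below f(phi x) need not factor through [phi]. *)
Lemma le_ge0_change_of_variables d1 d2 (T1 : measurableType d1)
    (T2 : measurableType d2) (R : realType)
    (mu : {measure set T1 -> \bar R}) (nu : {measure set T2 -> \bar R})
    (phi : T1 -> T2) (c k : R) :
  measurable_fun setT phi -> (0 <= c)%R -> (0 < k)%R ->
  (forall A, measurable A -> mu (phi @^-1` A) = c%:E * nu A) ->
  forall f : T2 -> \bar R, (forall x, 0 <= f x) ->
  (k * c)%:E * \int[nu]_y f y <= \int[mu]_x (k%:E * f (phi x)).
Proof.
move=> mphi c0 k0 muE f f0.
have [->|c0'] := eqVneq c 0%R.
  rewrite mulr0 mul0e; apply: integral_ge0 => x _.
  by rewrite mule_ge0// lee_fin ltW.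
have {c0 c0'}c0 : (0 < c)%R by rewrite lt_def c0'.
have kc0 : (0 < k * c)%R by rewrite mulr_gt0.
rewrite muleC -lee_pdivlMr//.
apply: le_nnintegralP => // h hf.
rewrite lee_pdivlMr// muleC.
apply: (@le_trans _ _ (\int[mu]_x (k%:E * (h (phi x))%:E))); last first.
  apply: le_nnintegral => x; first by rewrite mule_ge0// lee_fin// ltW.
  by rewrite lee_pmul2l.
have mh : measurable_fun setT (fun x => (h x)%:E) by exact/measurable_EFinP.
have h0 x : 0 <= (h x)%:E by rewrite lee_fin.
have mhphi : measurable_fun setT (fun x => (h (phi x))%:E).
  exact: (measurableT_comp mh mphi).
rewrite ge0_integralZl//; last by rewrite lee_fin ltW.
rewrite -(ge0_integral_pushforward mphi mu _ mh)//.
(* The image of [mu] under [phi] agrees with c times [nu] on measurable sets. *)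
rewrite [X in _ <= _ * X](eq_measure_integral (mscale (NngNum (ltW c0)) nu)).
  by rewrite ge0_integral_mscale//= muleA EFinM.
by move=> A mA _; rewrite -[RHS]muE.
Qed.

(* [f] need not be measurable: this spares proving measurability of the
   functions [fourier1 (u k)] occurring in [is_fourier]. *)
Lemma integral_change_of_variables d1 d2 (T1 : measurableType d1)
    (T2 : measurableType d2) (R : realType)
    (mu : {measure set T1 -> \bar R}) (nu : {measure set T2 -> \bar R})
    (phi : T1 -> T2) (psi : T2 -> T1) (c k : R) :
  measurable_fun setT phi -> measurable_fun setT psi ->
  cancel phi psi -> cancel psi phi -> (0 < c)%R -> (0 < k)%R ->
  (forall A, measurable A -> mu (phi @^-1` A) = c%:E * nu A) ->
  forall f : T2 -> \bar R,
  \int[mu]_x (k%:E * f (phi x)) = (k * c)%:E * \int[nu]_y f y.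
Proof.
move=> mphi mpsi phiK psiK c0 k0 muE.
have kc0 : (0 < k * c)%R by rewrite mulr_gt0.
have ge0 (f : T2 -> \bar R) : (forall x, 0 <= f x) ->
    \int[mu]_x (k%:E * f (phi x)) = (k * c)%:E * \int[nu]_y f y.
  move=> f0; apply/eqP; rewrite eq_le; apply/andP; split; last first.
    by apply: le_ge0_change_of_variables => //; exact: ltW.
  (* The reverse inequality is the same lemma for [psi], with inverted constants and the function k
     f(phi x). *)
  have muE' A : measurable A -> nu (psi @^-1` A) = c^-1%:E * mu A.
    move=> mA; have mA' : measurable (psi @^-1` A).
      by rewrite -[X in measurable X]setTI; exact: mpsi.
    have E : phi @^-1` (psi @^-1` A) = A.
      by apply/seteqP; split=> x /=; rewrite phiK.
    by rewrite -[in RHS]E (muE _ mA') muleA -EFinM mulVf ?mul1e ?gt_eqF.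
  have kf0 x : 0 <= k%:E * f (phi x) by rewrite mule_ge0// lee_fin ltW.
  have c'0 : (0 <= c^-1)%R by rewrite invr_ge0 ltW.
  have k'0 : (0 < k^-1)%R by rewrite invr_gt0.
  have := le_ge0_change_of_variables mpsi c'0 k'0 muE' kf0; rewrite -invfM.
  under [X in _ <= X]eq_integral do
    rewrite psiK muleA -EFinM mulVf ?gt_eqF// mul1e.
  by rewrite muleC lee_pdivrMr// muleC.
move=> f.
rewrite [LHS]integralE [in RHS]integralE.
transitivity (\int[mu]_x (k%:E * f^\+ (phi x)) -
    \int[mu]_x (k%:E * f^\- (phi x))).
  congr (_ - _); apply: eq_integral => x _.
    by rewrite !funeposE maxe_pMr ?mule0// ltW.
  by rewrite !funenegE -muleN maxe_pMr ?mule0// ltW.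
rewrite !ge0//.
have := @integral_ge0 _ _ _ nu setT f^\+ (fun x _ => funepos_ge0 f x).
have := @integral_ge0 _ _ _ nu setT f^\- (fun x _ => funeneg_ge0 f x).
(* Either part may have an infinite integral. By convention +oo - +oo is -oo, and the positive
   factor k c preserves infinite values, so every case agrees. *)
move: (\int[nu]_x _) (\int[nu]_x _) => [a| |] [b| |]//= a0 b0.
- by rewrite -EFinM -!EFinD -!EFinM mulrBr.
- by rewrite gt0_muley ?lte_fin//= gt0_muleNy ?lte_fin.
- by rewrite gt0_muley ?lte_fin//.
- by rewrite gt0_muley ?lte_fin//= gt0_muleNy ?lte_fin.
Qed.

End change_of_variables.

(** * Lebesgue measure on tuples: translations, cubes, sigma-finiteness *)

Section lebesgue_tuple.
Context (R : realType).
Local Notation rtuple n := (n.-tuple (measurableTypeR R)).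
Implicit Types (n : nat).

(** The image measure under the translation gives each half-open interval its length, which
    characterises Lebesgue measure. *)
Lemma lebesgue_measure_translation (s : R) (A : set (measurableTypeR R)) :
  measurable A ->
  lebesgue_measure ((fun x : R => x + s) @^-1` A) = lebesgue_measure A.
Proof.
move=> mA; have mf : measurable_fun setT
    ((fun x : R => x + s) : measurableTypeR R -> measurableTypeR R).
  by apply: measurable_funD => //; exact: measurable_cst.
apply/esym.
apply: (lebesgue_measure_unique
  (mu := pushforward_measure lebesgue_measure mf)) => //.
move=> _ [[a b] _ <-].
rewrite [RHS]/=/pushforward.
have -> : (fun x : R => x + s) @^-1` `]a, b]%classic = `]a - s, b - s]%classic.
  by apply/seteqP; split=> x /=; rewrite !in_itv/= ltrBlDr lerBrDr.
rewrite !lebesgue_measure_itv/= !lte_fin ltrD2r -!EFinB.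
by case: ifP => // _; congr _%:E; ring.
Qed.

Definition tuple_add n (s t : rtuple n) : rtuple n :=
  [tuple (tnth s i : R) + tnth t i | i < n].

Definition tuple_opp n (s : rtuple n) : rtuple n :=
  [tuple - (tnth s i : R) | i < n].

Lemma tuple_addK n (s : rtuple n) :
  cancel (fun t => tuple_add t s) (fun t => tuple_add t (tuple_opp s)).
Proof. by move=> t; apply: eq_from_tnth => i; rewrite !tnth_mktuple addrK. Qed.

Lemma tuple_subK n (s : rtuple n) :
  cancel (fun t => tuple_add t (tuple_opp s)) (fun t => tuple_add t s).
Proof. by move=> t; apply: eq_from_tnth => i; rewrite !tnth_mktuple subrK. Qed.

Lemma tuple_addC n (s t : rtuple n) : tuple_add s t = tuple_add t s.
Proof. by apply: eq_from_tnth => i; rewrite !tnth_mktuple addrC. Qed.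

Lemma tuple_oppB n (s t : rtuple n) :
  tuple_opp (tuple_add s (tuple_opp t)) = tuple_add t (tuple_opp s).
Proof. by apply: eq_from_tnth => i; rewrite !tnth_mktuple opprB. Qed.

Lemma measurable_tuple_add n d (T : measurableType d) (f g : T -> rtuple n) :
  measurable_fun setT f -> measurable_fun setT g ->
  measurable_fun setT (fun x => tuple_add (f x) (g x)).
Proof.
move=> /measurable_fun_tnthP mf /measurable_fun_tnthP mg.
apply/measurable_fun_tnthP => i.
rewrite (_ : _ \o _ = fun x => (tnth (f x) i : R) + tnth (g x) i).
  by apply: measurable_funD; [exact: mf | exact: mg].
by apply/funext => x /=; rewrite tnth_mktuple.
Qed.

Lemma measurable_tuple_opp n d (T : measurableType d) (f : T -> rtuple n) :
  measurable_fun setT f -> measurable_fun setT (fun x => tuple_opp (f x)).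
Proof.
move=> /measurable_fun_tnthP mf; apply/measurable_fun_tnthP => i.
rewrite (_ : _ \o _ = fun x => - (tnth (f x) i : R)).
  by apply: measurableT_comp => //; exact: mf.
by apply/funext => x /=; rewrite tnth_mktuple.
Qed.

Lemma measurable_tuple_addr n (s : rtuple n) :
  measurable_fun setT (fun t => tuple_add t s).
Proof. by apply: measurable_tuple_add => //; exact: measurable_cst. Qed.

Lemma tuple_add_cons n (t : rtuple n) (x : R) (s : rtuple n.+1) :
  tuple_add (cons_pair (t, x)) s =
  cons_pair (tuple_add t [tuple of behead s], x + thead s).
Proof.
apply: eq_from_tnth => i; rewrite tnth_mktuple.
case: (unliftP ord0 i) => [j|] ->; last by rewrite !tnth0.
rewrite !tnthS tnth_mktuple tnth_behead; congr (_ + tnth s _).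
by apply: val_inj; rewrite /= inordK ?bump0 ?ltnS.
Qed.

Lemma lebesgue_tupleS n (A : set (rtuple n.+1)) :
  lebesgue_tuple R n.+1 A =
  (\int[lebesgue_tuple R n]_t
     lebesgue_measure (xsection (@cons_pair R n @^-1` A) t))%E.
Proof. by []. Qed.

(** By induction on [n], in the iterated integral: shifting the tail is a change of variables
    supplied by the induction hypothesis, and shifting the head is one-dimensional invariance
    applied to each section. *)
Lemma lebesgue_tuple_translation n (s : rtuple n) (A : set (rtuple n)) :
  measurable A ->
  lebesgue_tuple R n ((fun t => tuple_add t s) @^-1` A) = lebesgue_tuple R n A.
Proof.
elim: n s A => [s A _|n IH s A mA].
  by congr (lebesgue_tuple R 0 _); apply/seteqP; split=> t /=;
     rewrite (tuple0 (tuple_add t s)) (tuple0 t).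
rewrite !lebesgue_tupleS.
have mA' : measurable (@cons_pair R n @^-1` A).
  by rewrite -[X in measurable X]setTI; exact: measurable_cons_pair.
pose b := [tuple of behead s].
pose F t := lebesgue_measure (xsection (@cons_pair R n @^-1` A) t).
have mb := @measurable_tuple_addr n.
have LE B : measurable B ->
    lebesgue_tuple R n ((fun t => tuple_add t b) @^-1` B) =
    (1%:E * lebesgue_tuple R n B)%E by move=> mB; rewrite mul1e IH.
have := integral_change_of_variables (mb b) (mb (tuple_opp b))
  (tuple_addK b) (tuple_subK b) ltr01 ltr01 LE F.
rewrite mul1r mul1e => <-; apply: eq_integral => t _; rewrite mul1e.
rewrite -[RHS](lebesgue_measure_translation (thead s)); last first.
  exact: measurable_xsection.
by congr lebesgue_measure; apply/seteqP; split=> x;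
   rewrite /xsection/= !inE/= tuple_add_cons.
Qed.

(** These cubes are symmetric about 0, have finite measure and exhaust the space. They witness
    sigma-finiteness, and the one with r = 1 later serves as the reference set for comparing
    measures. *)
Definition tuple_box n (r : R) : set (rtuple n) :=
  [set t | forall i, `|tnth t i : R| <= r].

Lemma measurable_tuple_box n r : measurable (@tuple_box n r).
Proof.
have -> : @tuple_box n r = \bigcap_(i in [set: 'I_n])
    ((fun t : rtuple n => tnth t i) @^-1` `[- r, r]%classic).
  apply/seteqP; split=> t bt i.
    by move=> _; have := bt i; rewrite /= in_itv/= ler_norml.
  by have := bt i I; rewrite /= in_itv/= ler_norml.
apply: fin_bigcap_measurable; first exact: finite_finset.
move=> i _; rewrite -[X in measurable X]setTI.
exact: measurable_tnth.
Qed.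

Lemma lebesgue_tuple_box n r : 0 <= r ->
  lebesgue_tuple R n (tuple_box r) = ((r *+ 2) ^+ n)%:E.
Proof.
move=> r0; elim: n => [|n IH].
  by rewrite /= diracE mem_set// => -[].
rewrite lebesgue_tupleS.
have -> : @cons_pair R n @^-1` tuple_box r = tuple_box r `*` `[- r, r]%classic.
  apply/seteqP; split=> [[t x] H|[t x] [/= H1 H2] i].
    split => /=; last by have := H ord0; rewrite in_itv/= -ler_norml tnth0.
    by move=> i; have := H (lift ord0 i); rewrite tnthS.
  case: (unliftP ord0 i) => [j|] ->; first by rewrite tnthS.
  by rewrite tnth0/= ler_norml; rewrite in_itv/= in H2.
transitivity ((lebesgue_tuple R n \x @lebesgue_measure R)%E
   (tuple_box r `*` `[- r, r]%classic)) => //.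
rewrite product_measure1E; last 2 first.
- exact: measurable_tuple_box.
- by [].
transitivity (((r *+ 2) ^+ n)%:E * @lebesgue_measure R `[(- r)%R, r]%classic)%E.
  by rewrite -IH.
rewrite lebesgue_measure_itv/= lte_fin.
(* The interval formula tests its endpoints strictly, so r = 0 falls in its other branch, with value
   0. *)
have [->|rN0] := eqVneq r 0.
  by rewrite oppr0 ltxx mule0 mul0rn exprS mul0r.
have rp : 0 < r by rewrite lt_def rN0.
by rewrite gtrN// opprK -EFinD -EFinM -mulr2n exprSr.
Qed.

Lemma lebesgue_tuple_sigma_finite n : sigma_finite setT (lebesgue_tuple R n).
Proof.
exists (fun k => tuple_box k%:R).
  apply/seteqP; split=> // t _.
  have [k kP] : exists k, forall i, `|tnth t i : R| <= k%:R.
    pose b i := Num.bound `|tnth t i : R|.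
    exists (\max_i b i)%N => i; apply: (@le_trans _ _ (b i)%:R).
      exact/ltW/archi_boundP/normr_ge0.
    by rewrite ler_nat leq_bigmax.
  by exists k.
move=> k; split; first exact: measurable_tuple_box.
by rewrite lebesgue_tuple_box// ltry.
Qed.

End lebesgue_tuple.

(** * Uniqueness of translation-invariant measures; invertible matrices *)

Section linear_change_of_variables.
Context (R : realType).
Local Notation rtuple n := (n.-tuple (measurableTypeR R)).
Implicit Types (n : nat).

(** Tonelli for the indicator of [S], from the uniqueness of the product measure. Sigma-finiteness
    is a proposition here, so [HB.pack] first turns it into structure on the measures. *)
Lemma product_measure12 d1 d2 (T1 : measurableType d1) (T2 : measurableType d2)
    (mu : {measure set T1 -> \bar R}) (nu : {measure set T2 -> \bar R}) :
  sigma_finite setT mu -> sigma_finite setT nu ->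
  forall S, measurable S ->
  (\int[mu]_x nu (xsection S x) = \int[nu]_y mu (ysection S y))%E.
Proof.
move=> sf1 sf2 S mS.
pose m1 : {sigma_finite_measure set T1 -> \bar R} :=
  HB.pack (Measure.sort mu) (Measure.class mu)
      (isSFinite.Build _ _ _ mu (sfinite_measure_sigma_finite sf1))
      (isSigmaFinite.Build _ _ _ mu sf1).
pose m2 : {sigma_finite_measure set T2 -> \bar R} :=
  HB.pack (Measure.sort nu) (Measure.class nu)
      (isSFinite.Build _ _ _ nu (sfinite_measure_sigma_finite sf2))
      (isSigmaFinite.Build _ _ _ nu sf2).
apply: (@product_measure_unique _ _ T1 T2 R m1 m2 (m1 \x^ m2)%E) => //.
by move=> A B mA mB; exact: product_measure2E.
Qed.

(* Compute the product measure of the pairs [(x, y)] with [y] in [B] and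
   [x + y] in [A], and of their images under [y := x + y], in both orders. *)
Lemma translation_invariant_unique n (mu : {measure set (rtuple n) -> \bar R})
    (A B : set (rtuple n)) :
  sigma_finite setT mu ->
  (forall s C, measurable C -> mu ((fun t => tuple_add t s) @^-1` C) = mu C) ->
  measurable A -> measurable B -> (forall t, B (tuple_opp t) <-> B t) ->
  (mu A * lebesgue_tuple R n B = lebesgue_tuple R n A * mu B)%E.
Proof.
move=> sfmu muT mA mB symB; set L := lebesgue_tuple R n.
have sfL : sigma_finite setT L by exact: lebesgue_tuple_sigma_finite.
pose S := [set p : rtuple n * rtuple n | B p.2 /\ A (tuple_add p.1 p.2)].
pose S' := [set p : rtuple n * rtuple n |
   B (tuple_add p.2 (tuple_opp p.1)) /\ A p.2].
have mS : measurable S.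
  have -> : S = (snd @^-1` B) `&`
      ((fun p : rtuple n * rtuple n => tuple_add p.1 p.2) @^-1` A) by [].
  apply: measurableI; rewrite -[X in measurable X]setTI.
    exact: measurable_snd.
  exact: measurable_tuple_add.
have mS' : measurable S'.
  have -> : S' = ((fun p : rtuple n * rtuple n =>
      tuple_add p.2 (tuple_opp p.1)) @^-1` B) `&` (snd @^-1` A) by [].
  apply: measurableI; rewrite -[X in measurable X]setTI; last first.
    exact: measurable_snd.
  by apply: measurable_tuple_add => //; exact: measurable_tuple_opp.
have intE (nu m : {measure set (rtuple n) -> \bar R}) (C D : set (rtuple n)) :
    measurable C ->
    (\int[nu]_y ((\1_C y)%:E * m D) = m D * nu C)%E.
  move=> mC; rewrite ge0_integralZr//; last by apply: measurableT_comp.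
  by rewrite integral_indic// setIT muleC.
(* For y in [B] the section of [S] is a translate of [A], of measure mu A; for other y it is
   empty. *)
transitivity (\int[L]_y mu (ysection S y))%E.
  rewrite -intE//; apply: eq_integral => y _.
  rewrite indicE; have [/set_mem By|/negP nBy] := boolP (y \in B).
    rewrite mul1e -(muT y A mA); congr (mu _).
    by apply/seteqP; split=> x; rewrite /ysection/= inE /S/=; [|case].
  rewrite mul0e (_ : ysection S y = set0) ?measure0//.
  by apply/seteqP; split=> x //; rewrite /ysection/= inE /S/= => -[By _];
    apply: nBy; rewrite inE.
rewrite -product_measure12//.
(* The section of [S] at x is the preimage of that of [S'] under y := y + x, so invariance of [L]
   applies. *)
transitivity (\int[mu]_x L (xsection S' x))%E.
  apply: eq_integral => x _.
  have mX : measurable (xsection S' x) by exact: measurable_xsection.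
  rewrite -[RHS](lebesgue_tuple_translation x mX).
  congr (L _); apply/seteqP; split=> y; rewrite /xsection/= !inE /S /S'/=;
    by rewrite tuple_addK tuple_addC.
rewrite product_measure12//.
rewrite muleC -intE//; apply: eq_integral => y _.
rewrite indicE; have [/set_mem Ay|/negP nAy] := boolP (y \in A); last first.
  rewrite mul0e (_ : ysection S' y = set0) ?measure0//.
  by apply/seteqP; split=> x //; rewrite /ysection/= inE /S'/= => -[_ Ay];
    apply: nAy; rewrite inE.
(* By symmetry of [B], y - x lies in [B] exactly when x - y does, so this section is a translate of
   [B]. *)
rewrite mul1e -(muT (tuple_opp y) B mB); congr (mu _).
apply/seteqP; split=> x; rewrite /ysection/= inE /S'/= -symB tuple_oppB//.
by case.
Qed.

Definition tuple_mulmx n (M : 'M[R]_n) (t : rtuple n) : rtuple n :=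
  [tuple \sum_j M i j * (tnth t j : R) | i < n].

Lemma measurable_tuple_mulmx n (M : 'M[R]_n) :
  measurable_fun setT (tuple_mulmx M).
Proof.
apply/measurable_fun_tnthP => i.
rewrite (_ : _ \o _ = fun t : rtuple n => \sum_j M i j * (tnth t j : R)).
  apply: measurable_sum => j; apply: measurable_funM.
    exact: measurable_cst.
  exact: measurable_tnth.
by apply/funext => x /=; rewrite tnth_mktuple.
Qed.

Lemma tuple_mulmxM n (M N : 'M[R]_n) t :
  tuple_mulmx (M *m N) t = tuple_mulmx M (tuple_mulmx N t).
Proof.
apply: eq_from_tnth => i; rewrite !tnth_mktuple.
under [RHS]eq_bigr do rewrite tnth_mktuple mulr_sumr.
rewrite exchange_big/=; apply: eq_bigr => j _.
by rewrite mxE mulr_suml; apply: eq_bigr => k _; rewrite mulrA.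
Qed.

Lemma tuple_mul1mx n (t : rtuple n) : tuple_mulmx 1%:M t = t.
Proof.
apply: eq_from_tnth => i; rewrite tnth_mktuple (bigD1 i)//= mxE eqxx mul1r.
by rewrite big1 ?addr0// => j ji; rewrite mxE eq_sym (negbTE ji) mul0r.
Qed.

Lemma tuple_mulmx_add n (M : 'M[R]_n) s t :
  tuple_mulmx M (tuple_add s t) = tuple_add (tuple_mulmx M s) (tuple_mulmx M t).
Proof.
apply: eq_from_tnth => i; rewrite !tnth_mktuple -big_split/=.
by apply: eq_bigr => j _; rewrite tnth_mktuple mulrDr.
Qed.

Lemma tuple_mulmxK n (M : 'M[R]_n) : M \in unitmx ->
  cancel (tuple_mulmx M) (tuple_mulmx (invmx M)).
Proof. by move=> uM t; rewrite -tuple_mulmxM mulVmx// tuple_mul1mx. Qed.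

Lemma tuple_mulmxVK n (M : 'M[R]_n) : M \in unitmx ->
  cancel (tuple_mulmx (invmx M)) (tuple_mulmx M).
Proof. by move=> uM t; rewrite -tuple_mulmxM mulmxV// tuple_mul1mx. Qed.

(** The image of Lebesgue measure under [M] is sigma-finite and translation invariant, hence
    proportional to Lebesgue measure. The factor is read off on the cube [B], whose image measure
    must be shown positive and finite. *)
Lemma lebesgue_tuple_mulmx n (M : 'M[R]_n) : M \in unitmx ->
  exists2 c : R, 0 < c & forall A, measurable A ->
    lebesgue_tuple R n (tuple_mulmx M @^-1` A) =
    (c%:E * lebesgue_tuple R n A)%E.
Proof.
move=> uM; set L := lebesgue_tuple R n.
have mT N A : measurable A -> measurable (@tuple_mulmx n N @^-1` A).
  move=> mA; rewrite -[X in measurable X]setTI.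
  exact: measurable_tuple_mulmx.
pose mu := pushforward_measure L (measurable_tuple_mulmx M).
have muE A : mu A = L (tuple_mulmx M @^-1` A) by [].
have sfmu : sigma_finite setT mu.
  have [F FT Foo] := lebesgue_tuple_sigma_finite R n.
  exists (fun k => tuple_mulmx (invmx M) @^-1` F k).
    by rewrite -preimage_bigcup -FT.
  move=> k; have [mF Fk] := Foo k; split; first exact: mT.
  rewrite muE (_ : _ @^-1` _ = F k)//.
  by apply/seteqP; split=> t /=; rewrite tuple_mulmxK.
have muT s C : measurable C -> mu ((fun t => tuple_add t s) @^-1` C) = mu C.
  move=> mC; rewrite !muE.
  (* Since M t + s = M (t + M^-1 s), a shift by s in the target is a shift by M^-1 s in the
     source. *)
  rewrite -(lebesgue_tuple_translation (tuple_mulmx (invmx M) s) (mT M _ mC)).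
  congr (L _); apply/seteqP; split=> t /=;
  by rewrite tuple_mulmx_add tuple_mulmxVK.
pose B : set (rtuple n) := tuple_box 1.
have mB : measurable B by exact: measurable_tuple_box.
have symB t : B (tuple_opp t) <-> B t.
  by split=> H i; have := H i; rewrite tnth_mktuple normrN.
have key A mA := translation_invariant_unique sfmu muT mA mB symB (A := A).
have LB : L B = ((1 *+ 2) ^+ n)%:E by rewrite /L lebesgue_tuple_box.
have muBoo : (mu B < +oo)%E.
  (* [K] bounds every absolute row sum of M^-1, so the preimage of [B] under [M] lies in the cube of
     radius [K]. *)
  pose K := \sum_i \sum_j `|invmx M i j|.
  have K0 : 0 <= K by do 2 (apply: sumr_ge0 => ? _).
  apply: (@le_lt_trans _ _ (L (tuple_box K))); last first.
    by rewrite /L lebesgue_tuple_box// ltry.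
  rewrite muE; apply: (@le_measure _ _ _ L); rewrite ?inE//.
  - exact: mT.
  - exact: measurable_tuple_box.
  move=> t /= Bt i; rewrite -[t](tuple_mulmxK uM) tnth_mktuple.
  apply: (le_trans (ler_norm_sum _ _ _)).
  apply: (@le_trans _ _ (\sum_j `|invmx M i j|)).
    by apply: ler_sum => j _; rewrite normrM ler_piMr//; exact: Bt.
  by rewrite /K [leRHS](bigD1 i)//= lerDl; do 2 (apply: sumr_ge0 => ? _).
have e2 : (0 < (1 *+ 2 : R) ^+ n) by rewrite exprn_gt0// ltr0n.
have muB0 : (0 < mu B)%E.
  rewrite lt0e measure_ge0 andbT; apply/eqP => muB.
  (* If mu B were 0, comparing the whole space with [B] would give it mu-measure 0; but that measure
     is L setT, which is at least L B > 0. *)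
  have := key setT measurableT; rewrite muB mule0 LB => /eqP.
  rewrite mule_eq0 eqe (gt_eqF e2) orbF => /eqP muT0.
  have : (L B <= mu setT)%E.
    by rewrite muE preimage_setT; apply: (@le_measure _ _ _ L); rewrite ?inE.
  by rewrite muT0 LB lee_fin leNgt e2.
exists (fine (mu B) / (1 *+ 2) ^+ n).
  by rewrite divr_gt0// fine_gt0// muB0 muBoo.
move=> A mA; have := key A mA; rewrite LB.
have muBf : mu B = (fine (mu B))%:E by rewrite fineK// ge0_fin_numE// ltW.
rewrite muBf => E.
rewrite -[LHS]/(mu A) EFinM muleAC [((fine _)%:E * _)%E]muleC -E.
by rewrite -muleA -EFinM mulfV ?mule1// gt_eqF.
Qed.

Lemma col_of_tuple_mulmx n (M : 'M[R]_n) t :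
  col_of_tuple (tuple_mulmx M t) = M *m col_of_tuple t.
Proof.
apply/colP => i; rewrite !mxE tnth_mktuple.
by apply: eq_bigr => j _; rewrite mxE.
Qed.

Lemma lebesgue_Rn_mulmx n (M : 'M[R]_n) : M \in unitmx ->
  exists2 c : R, 0 < c & forall A : set (borel 'cV[R]_n), measurable A ->
    lebesgue_Rn R n (mulmx M @^-1` A) = (c%:E * lebesgue_Rn R n A)%E.
Proof.
move=> uM; have [c c0 cE] := lebesgue_tuple_mulmx uM.
exists c => // A mA; rewrite -[RHS]cE; last first.
  by rewrite -[X in measurable X]setTI; exact: measurable_col_of_tuple.
congr (lebesgue_tuple R n _); apply/seteqP; split=> t /=;
by rewrite col_of_tuple_mulmx.
Qed.

End linear_change_of_variables.

(** * Change of variables for complex integrals and L^p norms *)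

Section complex_change_of_variables.
Local Open Scope complex_scope.
Context d1 d2 (T1 : measurableType d1) (T2 : measurableType d2) (R : realType).
Variables (mu : {measure set T1 -> \bar R}) (nu : {measure set T2 -> \bar R}).
Variables (phi : T1 -> T2) (psi : T2 -> T1) (c : R).
Hypotheses (mphi : measurable_fun setT phi) (mpsi : measurable_fun setT psi).
Hypotheses (phiK : cancel phi psi) (psiK : cancel psi phi).
Hypothesis c0 : 0 < c.
Hypothesis muE : forall A, measurable A -> mu (phi @^-1` A) = (c%:E * nu A)%E.
Implicit Types (f g : T2 -> R[i]) (s r : R).

Lemma Re_scale s (z : R[i]) : complex.Re (s%:C * z) = s * complex.Re z.
Proof. by case: z => a b /=; rewrite mul0r subr0. Qed.

Lemma Im_scale s (z : R[i]) : complex.Im (s%:C * z) = s * complex.Im z.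
Proof. by case: z => a b /=; rewrite mul0r addr0. Qed.

Lemma normc_scale s (z : R[i]) : 0 <= s ->
  ComplexField.Normc.normc (s%:C * z) = s * ComplexField.Normc.normc z.
Proof.
move=> s0; rewrite ComplexField.Normc.normcM; congr (_ * _).
by rewrite /= expr0n addr0 sqrtr_sqr ger0_norm.
Qed.

Lemma cmeasurable_comp f s :
  cmeasurable f -> cmeasurable (fun x => s%:C * f (phi x)).
Proof.
move=> [mRe mIm]; split.
- rewrite (_ : (fun x => _) = fun x => s * complex.Re (f (phi x))).
    apply: measurable_funM; first exact: measurable_cst.
    exact: (measurableT_comp mRe mphi).
  by apply/funext => x; rewrite Re_scale.
- rewrite (_ : (fun x => _) = fun x => s * complex.Im (f (phi x))).
    apply: measurable_funM; first exact: measurable_cst.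
    exact: (measurableT_comp mIm mphi).
  by apply/funext => x; rewrite Im_scale.
Qed.

Lemma Rintegral_change_of_variables (f : T2 -> R) s : 0 < s ->
  \int[mu]_x (s * f (phi x)) = s * c * \int[nu]_y f y.
Proof.
move=> s0; rewrite /Rintegral.
under eq_integral do rewrite EFinM.
rewrite (integral_change_of_variables mphi mpsi phiK psiK c0 s0 muE
  (fun y => (f y)%:E)).
have sc0 : 0 < s * c by rewrite mulr_gt0.
(* [fine] sends infinite integrals to 0, and a positive factor keeps them infinite, so both sides
   are then 0. *)
by case: (integral _ _ _) => [a| |]//;
  rewrite ?gt0_muley ?gt0_muleNy ?lte_fin//= mulr0.
Qed.

Lemma cintegral_change_of_variables f s : 0 < s ->
  cintegral mu (fun x => s%:C * f (phi x)) = (s * c)%:C * cintegral nu f.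
Proof.
move=> s0; rewrite /cintegral.
under eq_Rintegral do rewrite Re_scale.
under [X in _ +i* X]eq_Rintegral do rewrite Im_scale.
rewrite (Rintegral_change_of_variables (fun y => complex.Re (f y)))//.
rewrite (Rintegral_change_of_variables (fun y => complex.Im (f y)))//.
by apply/eqP; rewrite eq_complex /= !mul0r subr0 addr0 !eqxx.
Qed.

(** The factor s enters the integral as s^r, the substitution contributes c, and the outer r-th root
    acts on their product. *)
Lemma cLnorm_change_of_variables f s r : 0 < s -> 0 < r ->
  cLnorm mu r%:E (fun x => s%:C * f (phi x)) =
  (((s `^ r * c) `^ r^-1)%:E * cLnorm nu r%:E f)%E.
Proof.
move=> s0 r0; rewrite /cLnorm unlock.
have sr0 : 0 < s `^ r by rewrite powR_gt0.
pose F y := (`|(ComplexField.Normc.normc (f y))%:E| `^ r)%E.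
rewrite (eq_integral (fun x => ((s `^ r)%:E * F (phi x))%E)); last first.
  move=> x _; rewrite normc_scale ?ltW// EFinM abseM poweRM//.
  by rewrite /= gtr0_norm.
rewrite (integral_change_of_variables mphi mpsi phiK psiK c0 sr0 muE F).
rewrite poweRM//; first by rewrite lee_fin ltW// mulr_gt0.
by apply: integral_ge0 => y _; exact: poweR_ge0.
Qed.

Lemma Lp_change_of_variables f s r : 0 < s -> 0 < r ->
  Lp nu r%:E f -> Lp mu r%:E (fun x => s%:C * f (phi x)).
Proof.
move=> s0 r0 [mf foo]; split; first exact: cmeasurable_comp.
rewrite cLnorm_change_of_variables// lte_mul_pinfty//.
by rewrite lee_fin powR_ge0.
Qed.

Lemma cvg_Lp_change_of_variables (u : nat -> T2 -> R[i]) f s r :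
  0 < s -> 0 < r -> cvg_Lp nu r%:E u f ->
  cvg_Lp mu r%:E (fun k x => s%:C * u k (phi x)) (fun x => s%:C * f (phi x)).
Proof.
move=> s0 r0 uf; rewrite /cvg_Lp.
rewrite (_ : (fun k => _) = fun k =>
  (((s `^ r * c) `^ r^-1)%:E * cLnorm nu r%:E (fun x => u k x - f x)%R)%E).
  by rewrite -[0%E](mule0 ((s `^ r * c) `^ r^-1)%:E); apply: cvgeZl.
apply/funext => k; rewrite -cLnorm_change_of_variables//.
by congr cLnorm; apply/funext => x; rewrite mulrBr.
Qed.

Lemma ae_change_of_variables (P : T2 -> Prop) :
  {ae nu, forall y, P y} -> {ae mu, forall x, P (phi x)}.
Proof.
move=> [A [mA A0 sA]]; exists (phi @^-1` A); split.
- by rewrite -[X in measurable X]setTI; exact: mphi.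
- by rewrite muE// A0 mule0.
- by move=> x /= nP; apply: sA.
Qed.

Lemma inner_change_of_variables f g s : 0 < s ->
  inner mu (fun x => s%:C * f (phi x)) (fun x => s%:C * g (phi x)) =
  (s * s * c)%:C * inner nu f g.
Proof.
move=> s0; rewrite /inner -(cintegral_change_of_variables _ (mulr_gt0 s0 s0)).
congr cintegral; apply/funext => x.
case: (f _) (g _) => [a b] [a' b'].
by apply/eqP; rewrite eq_complex/=; apply/andP; split; apply/eqP; ring.
Qed.

End complex_change_of_variables.

(** * Borel measurability from continuity; continuity of matrix products *)

Section topology.

Lemma continuous_measurable_borel (T1 T2 : ptopologicalType) (f : T1 -> T2) :
  continuous f -> measurable_fun setT (f : borel T1 -> borel T2).
Proof.
move=> cf; apply: (@measurability _ _ _ (borel T2) _ _ (@open T2)) => //.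
move=> _ [A oA <-]; rewrite setTI; apply: sub_sigma_algebra.
by move/continuousP : cf; exact.
Qed.

Lemma continuous_mx (T : topologicalType) (R : topologicalType) m n
    (f : T -> 'M[R]_(m, n)) :
  (forall i j, continuous (fun x => f x i j)) -> continuous f.
Proof.
move=> cf x A [P nP sP].
have : \forall y \near x, forall i j, P i j (f y i j).
  apply: filter_forall => i; apply: filter_forall => j.
  exact: (cf i j x _ (nP i j)).
by apply: filterS => y Py; apply: sP.
Qed.

Lemma continuous_pair (T U W : topologicalType) (f : T -> U) (g : T -> W) :
  continuous f -> continuous g -> continuous (fun x => (f x, g x)).
Proof. by move=> cf cg x; apply: cvg_pair; [exact: cf|exact: cg]. Qed.

Lemma continuous_mulmxl (R : realType) m n p (M : 'M[R]_(m, n)) :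
  continuous (fun A : 'M[R]_(n, p) => M *m A).
Proof.
apply: continuous_mx => i j.
rewrite (_ : (fun x => _) = fun A : 'M[R]_(n, p) => \sum_k M i k * A k j).
  apply: continuous_big; first exact: add_continuous.
  move=> k _ A; apply: continuousM; first exact: cst_continuous.
  exact: coord_continuous.
by apply/funext => A; rewrite mxE.
Qed.

Lemma continuous_mulmxr (R : realType) m n p (M : 'M[R]_(n, p)) :
  continuous (fun A : 'M[R]_(m, n) => A *m M).
Proof.
apply: continuous_mx => i j.
rewrite (_ : (fun x => _) = fun A : 'M[R]_(m, n) => \sum_k A i k * M k j).
  apply: continuous_big; first exact: add_continuous.
  move=> k _ A; apply: continuousM; last exact: cst_continuous.
  exact: coord_continuous.
by apply/funext => A; rewrite mxE.
Qed.

End topology.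

(** * Conjugation by a dilation and transport of Haar measure *)

Section conjugation.
Context (R : realType) (n : nat).
Local Notation V := 'cV[R]_n.
Implicit Types (g h : GL R n) (x xi : V).

Lemma GL_valM g h : GL_val (g * h)%g = g *m h. Proof. by []. Qed.
Lemma GL_valV g : GL_val g^-1%g = invmx g. Proof. by []. Qed.

Lemma GL_mulKmx m g (A : 'M[R]_(n, m)) : GL_val g^-1%g *m (g *m A) = A.
Proof. by rewrite mulmxA GL_valV mulVmx ?GL_valP// mul1mx. Qed.

Lemma GL_mulVKmx m g (A : 'M[R]_(n, m)) : GL_val g *m (GL_val g^-1%g *m A) = A.
Proof. by rewrite mulmxA GL_valV mulmxV ?GL_valP// mul1mx. Qed.

Lemma GL_trmulKmx m g (A : 'M[R]_(n, m)) :
  (GL_val g)^T *m ((GL_val g^-1%g)^T *m A) = A.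
Proof. by rewrite mulmxA -trmx_mul GL_valV mulVmx ?GL_valP// trmx1 mul1mx. Qed.

Lemma GL_trmulVKmx m g (A : 'M[R]_(n, m)) :
  (GL_val g^-1%g)^T *m ((GL_val g)^T *m A) = A.
Proof. by rewrite mulmxA -trmx_mul GL_valV mulmxV ?GL_valP// trmx1 mul1mx. Qed.

Lemma dot0l x : dot 0 x = 0.
Proof. by apply: big1 => i _; rewrite mxE mul0r. Qed.

Lemma dot0r x : dot x 0 = 0.
Proof. by apply: big1 => i _; rewrite mxE mulr0. Qed.

Lemma dot_mulmx (A : 'M[R]_n) x y : dot x (A *m y) = dot (A^T *m x) y.
Proof.
suff dotE (u v : V) : dot u v = (u^T *m v) 0 0.
  by rewrite !dotE trmx_mul trmxK mulmxA.
by rewrite mxE; apply: eq_bigr => i _; rewrite mxE.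
Qed.

Lemma expi0 : expi (0 : R) = 1.
Proof. by rewrite /expi mulr0 cos0 sin0. Qed.

Lemma torus_expi0 : torus_expi (0 : R) = 1%g.
Proof. by apply: torus_val_inj; exact: expi0. Qed.

Lemma dilV g : (dil g)^-1%g = dil g^-1%g.
Proof.
rewrite /dil [LHS]/(aWH_inv _)/= /AWH; congr (_, _, _, _).
- by rewrite dot0l torus_expi0 invg1 mulg1.
- by rewrite mulmx0 oppr0.
- by rewrite mulmx0 oppr0.
Qed.

Lemma dilM g h : (dil g * dil h)%g = dil (g * h)%g.
Proof.
rewrite /dil [LHS]/(aWH_mul _ _)/= /AWH; congr (_, _, _, _).
- by rewrite dot0l torus_expi0 !mulg1.
- by rewrite mulmx0 addr0.
- by rewrite mulmx0 addr0.
Qed.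

Definition dil_conj g (a : aWH R n) : aWH R n := ((dil g)^-1 * a * dil g)%g.

(** Both phase factors of the group law vanish because [dil g] has zero translation and frequency
    parts. *)
Lemma dil_conjE g z x xi h :
  dil_conj g (AWH z x xi h) =
  AWH z (GL_val g^-1%g *m x) ((GL_val g)^T *m xi) (g^-1 * h * g)%g.
Proof.
rewrite /dil_conj dilV /dil [LHS]/(aWH_mul (aWH_mul _ _) _)/= /AWH.
congr (_, _, _, _).
- by rewrite dot0l !mulmx0 dot0r torus_expi0 mul1g !mulg1.
- by rewrite mulmx0 addr0 add0r.
- by rewrite mulmx0 addr0 add0r /invT invgK.
Qed.

Lemma dil_conjK g : cancel (dil_conj g) (dil_conj g^-1%g).
Proof. by move=> a; rewrite /dil_conj -dilV invgK !mulgA mulgV mul1g mulgK. Qed.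

Lemma dil_conjVK g : cancel (dil_conj g^-1%g) (dil_conj g).
Proof. by move=> a; rewrite -{1}(invgK g) dil_conjK. Qed.

Lemma dil_conjM g a b : dil_conj g (a * b)%g = (dil_conj g a * dil_conj g b)%g.
Proof. by rewrite /dil_conj !mulgA mulgK. Qed.

(** Writing the image under this bijection as a preimage under its inverse suits image measures and
    membership tests. *)
Lemma conjugate_byE g (S : set (aWH R n)) :
  conjugate_by (dil g) S = dil_conj g^-1%g @^-1` S.
Proof.
apply/seteqP; split=> [_ [a Sa <-]|a /= Sa]; first by rewrite /= dil_conjK.
by exists (dil_conj g^-1%g a) => //; exact: dil_conjVK.
Qed.

Lemma conjugate_byK (G : groupType) (x : G) (S : set G) :
  conjugate_by x^-1%g (conjugate_by x S) = S.
Proof.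
apply/seteqP; split=> [_ [_ [a Sa <-] <-]|a Sa].
  by rewrite invgK !mulgA mulgV mul1g mulgK.
exists (x^-1 * a * x)%g; first by exists a.
by rewrite invgK !mulgA mulgV mul1g mulgK.
Qed.

(** [GL] carries the topology induced from matrices, so continuity may be tested after the
    inclusion, where the map is a two-sided matrix product. *)
Lemma GL_conj_continuous g :
  continuous (fun h : GL R n => (g^-1 * h * g)%g : GL R n).
Proof.
apply: (@continuous_comp_initial _ _ _
  (set_val : set_type [set h : 'M[R]_n | h \in unitmx] -> _)).
rewrite (_ : _ \o _ = (fun A : 'M[R]_n => A *m g) \o
  ((fun A : 'M[R]_n => GL_val g^-1%g *m A) \o (@GL_val R n)))//.
move=> h; apply: continuous_comp; last exact: continuous_mulmxr.
apply: continuous_comp; last exact: continuous_mulmxl.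
exact: initial_continuous.
Qed.

Lemma dil_conj_continuous g : continuous (dil_conj g).
Proof.
rewrite (_ : dil_conj g = fun a : aWH R n =>
  (a.1.1.1, GL_val g^-1%g *m a.1.1.2, (GL_val g)^T *m a.1.2,
   (g^-1 * a.2 * g)%g)); last first.
  by apply/funext => -[[[z x] xi] h]; exact: dil_conjE.
have cc (T U W : topologicalType) (u : T -> U) (v : U -> W) :
    continuous u -> continuous v -> continuous (fun t => v (u t)).
  by move=> cu cv t; apply: continuous_comp; [exact: cu|exact: cv].
have cfst (T U : topologicalType) : continuous (@fst T U).
  by move=> x; exact: cvg_fst.
have csnd (T U : topologicalType) : continuous (@snd T U).
  by move=> x; exact: cvg_snd.
have c1 := cfst (torus R * V * V)%type (GL R n).
have c11 := cc _ _ _ _ _ c1 (cfst (torus R * V)%type V).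
apply: continuous_pair; last first.
  exact: (cc _ _ _ _ _ (csnd _ _) (@GL_conj_continuous g)).
apply: continuous_pair; last first.
  exact: (cc _ _ _ _ _ (cc _ _ _ _ _ c1 (csnd _ _))
    (@continuous_mulmxl _ _ _ _ _)).
apply: continuous_pair; last first.
  exact: (cc _ _ _ _ _ (cc _ _ _ _ _ c11 (csnd _ _))
    (@continuous_mulmxl _ _ _ _ _)).
exact: (cc _ _ _ _ _ c11 (cfst _ _)).
Qed.

Lemma measurable_dil_conj g :
  measurable_fun setT (dil_conj g : borel (aWH R n) -> borel (aWH R n)).
Proof.
apply: (@continuous_measurable_borel (aWH R n) (aWH R n)).
exact: dil_conj_continuous.
Qed.

(** Taking preimages under the conjugation reduces each condition to that for [G]: being a
    homeomorphism handles compact sets, being an automorphism handles left translates. *)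
Lemma left_haar_dil_conj g (G : set (aWH R n))
    (mu : {measure set (borel (aWH R n)) -> \bar R}) :
  left_haar G mu ->
  left_haar (conjugate_by (dil g) G)
    (pushforward_measure mu (measurable_dil_conj g)).
Proof.
move=> [muC muG muK muT].
have pre A : dil_conj g @^-1` (dil_conj g^-1%g @^-1` A) = A.
  by apply/seteqP; split=> a /=; rewrite dil_conjK.
rewrite conjugate_byE; split.
- by rewrite /= /pushforward preimage_setC pre.
- by rewrite /= /pushforward pre.
- move=> K cK KG; rewrite /= /pushforward.
  rewrite (_ : _ @^-1` _ = dil_conj g^-1%g @` K); last first.
    apply/seteqP; split=> [a Ka|_ [a Ka <-]]; last by rewrite /= dil_conjVK.
    by exists (dil_conj g a) => //; rewrite dil_conjK.
  apply: muK; last by move=> _ [a Ka <-]; exact: KG.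
  apply: continuous_compact => //; apply: continuous_subspaceT.
  exact: dil_conj_continuous.
- move=> x A Gx mA AG; rewrite /= /pushforward.
  have mA' : measurable (dil_conj g @^-1` A : set (borel (aWH R n))).
    by rewrite -[X in measurable X]setTI; exact: measurable_dil_conj.
  rewrite -[RHS](muT _ _ Gx mA'); last first.
    by move=> a /AG; rewrite /= dil_conjK.
  congr (mu _); apply/seteqP; split=> [a [y Ay xy]|_ [y Ay <-]].
    exists (dil_conj g^-1%g y); first by rewrite /= dil_conjVK.
    by rewrite -dil_conjM xy dil_conjK.
  by exists (dil_conj g y) => //; rewrite dil_conjM dil_conjVK.
Qed.

End conjugation.

(** * The dilation operator, the Fourier transform and the spaces [HU] *)

Section dilation.
Local Open Scope complex_scope.
Context (R : realType) (n : nat).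
Local Notation V := 'cV[R]_n.
Local Notation leb := (lebesgue_Rn R n).
Implicit Types (g h : GL R n) (f : V -> R[i]) (U : set V).

Definition undilate g f := qreg (dil g)^-1%g f.

(** This is |det g|^(1/2), in the form in which [dilation] produces it for g^-1. *)
Definition dil_factor g : R := (Num.sqrt `|\det (GL_val g^-1%g)|)^-1.

Lemma dil_factor_gt0 g : 0 < dil_factor g.
Proof.
rewrite invr_gt0 sqrtr_gt0 normr_gt0 -unitfE -unitmxE.
exact: GL_valP.
Qed.

Lemma undilateE g f : undilate g f = fun y => (dil_factor g)%:C * f (g *m y).
Proof.
apply/funext => y; rewrite /undilate dilV.
transitivity (1 * (expi (dot (y - 0) 0) * ((dil_factor g)%:C *
   f (GL_val g^-1^-1%g *m (y - 0))))) => //.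
by rewrite dot0r expi0 !mul1r invgK subr0.
Qed.

Lemma undilateK g : cancel (undilate g) (undilate g^-1%g).
Proof. by move=> f; rewrite /undilate -qregM !dilV invgK dilM mulgV qreg1. Qed.

Lemma undilateVK g : cancel (undilate g^-1%g) (undilate g).
Proof. by move=> f; rewrite -{1}(invgK g) undilateK. Qed.

(** With d = [dil g], multiplicativity gives pi(d^-1 a d) pi(d^-1) = pi(d^-1) pi(a): this is the
    intertwining relation on which all transfers rest. *)
Lemma qreg_undilate g a f :
  qreg (dil_conj g a) (undilate g f) = undilate g (qreg a f).
Proof. by rewrite /undilate /dil_conj -!qregM mulgK. Qed.

Lemma undilate0 g : undilate g (fun=> 0) = fun=> 0.
Proof. by rewrite undilateE; apply/funext => y; rewrite mulr0. Qed.

Lemma undilateD g (a : R[i]) f1 f2 :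
  undilate g (fun x => a * f1 x + f2 x) =
  fun x => a * undilate g f1 x + undilate g f2 x.
Proof. by rewrite !undilateE; apply/funext => y; rewrite mulrDr mulrCA. Qed.

Lemma undilateB g f1 f2 :
  undilate g (fun x => f1 x - f2 x) =
  fun x => undilate g f1 x - undilate g f2 x.
Proof. by rewrite !undilateE; apply/funext => y; rewrite mulrBr. Qed.

Lemma measurable_mulmx (M : 'M[R]_n) :
  measurable_fun setT (mulmx M : borel V -> borel V).
Proof.
apply: (@continuous_measurable_borel V V).
exact: continuous_mulmxl.
Qed.

Let mulmxK g : cancel (mulmx (GL_val g) : V -> V) (mulmx (GL_val g^-1%g)).
Proof. by move=> x; exact: GL_mulKmx. Qed.

Let mulmxVK g : cancel (mulmx (GL_val g^-1%g) : V -> V) (mulmx (GL_val g)).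
Proof. by move=> x; exact: GL_mulVKmx. Qed.

Let mulmxTK g :
  cancel (mulmx (GL_val g^-1%g)^T : V -> V) (mulmx (GL_val g)^T).
Proof. by move=> x; exact: GL_trmulKmx. Qed.

Let mulmxTVK g :
  cancel (mulmx (GL_val g)^T : V -> V) (mulmx (GL_val g^-1%g)^T).
Proof. by move=> x; exact: GL_trmulVKmx. Qed.

(** The factor combines [dil_factor g] with the scaling constant of [g]. Being common to all
    functions, it can be absorbed into the scalars in admissibility and boundedness. *)
Lemma cLnorm_undilate g : exists2 k : R, 0 < k & forall f,
  cLnorm leb 2%:E (undilate g f) = (k%:E * cLnorm leb 2%:E f)%E.
Proof.
have [c c0 cE] := lebesgue_Rn_mulmx (GL_valP g).
exists ((dil_factor g `^ 2 * c) `^ 2^-1) => [|f].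
  by rewrite powR_gt0// mulr_gt0// powR_gt0// dil_factor_gt0.
rewrite undilateE (cLnorm_change_of_variables (measurable_mulmx _)
  (measurable_mulmx _) (mulmxK g) (mulmxVK g) c0 cE)//.
exact: dil_factor_gt0.
Qed.

Lemma Lp_undilate g f (r : R) : 0 < r ->
  Lp leb r%:E f -> Lp leb r%:E (undilate g f).
Proof.
have [c c0 cE] := lebesgue_Rn_mulmx (GL_valP g).
move=> r0 Lf; rewrite undilateE.
exact: (Lp_change_of_variables (measurable_mulmx _)
  (measurable_mulmx _) (mulmxK g) (mulmxVK g) c0 cE (dil_factor_gt0 g)).
Qed.

Lemma cvg_Lp_undilate g (u : nat -> V -> R[i]) f (r : R) : 0 < r ->
  cvg_Lp leb r%:E u f ->
  cvg_Lp leb r%:E (fun k => undilate g (u k)) (undilate g f).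
Proof.
have [c c0 cE] := lebesgue_Rn_mulmx (GL_valP g).
move=> r0 uf.
rewrite (_ : (fun k => _) = fun k y => (dil_factor g)%:C * u k (g *m y)).
  rewrite undilateE.
  exact: (cvg_Lp_change_of_variables (measurable_mulmx _)
    (measurable_mulmx _) (mulmxK g) (mulmxVK g) c0 cE (dil_factor_gt0 g)).
by apply/funext => k; rewrite undilateE.
Qed.

Lemma inner_undilate g : exists2 k : R, 0 < k & forall f1 f2,
  inner leb (undilate g f1) (undilate g f2) = k%:C * inner leb f1 f2.
Proof.
have [c c0 cE] := lebesgue_Rn_mulmx (GL_valP g).
have s0 := dil_factor_gt0 g.
exists (dil_factor g * dil_factor g * c) => [|f1 f2].
  by rewrite !mulr_gt0.
by rewrite !undilateE (inner_change_of_variables (measurable_mulmx _)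
  (measurable_mulmx _) (mulmxK g) (mulmxVK g) c0 cE).
Qed.

Lemma ae_undilate g f1 f2 : {ae leb, forall y, f1 y = f2 y} ->
  {ae leb, forall y, undilate g f1 y = undilate g f2 y}.
Proof.
have [c c0 cE] := lebesgue_Rn_mulmx (GL_valP g).
move=> /(ae_change_of_variables (measurable_mulmx _) cE).
by apply: filterS => y; rewrite !undilateE => ->.
Qed.

Lemma ae_undilate_eq0 g f : {ae leb, forall y, f y = 0} ->
  {ae leb, forall y, undilate g f y = 0}.
Proof.
by move=> /(ae_undilate g (f2 := fun=> 0)); rewrite undilate0.
Qed.

(** Substituting y = g x turns the pairing of gamma with x into that of g^-T gamma with y. *)
Lemma fourier1_undilate g : exists2 t : R, 0 < t & forall f gamma,
  fourier1 (undilate g f) gamma =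
  t%:C * fourier1 f ((GL_val g^-1%g)^T *m gamma).
Proof.
have [c c0 cE] := lebesgue_Rn_mulmx (GL_valP g).
have s0 := dil_factor_gt0 g.
exists (dil_factor g * c) => [|f gamma]; first by rewrite mulr_gt0.
rewrite /fourier1 -(cintegral_change_of_variables (measurable_mulmx _)
  (measurable_mulmx _) (mulmxK g) (mulmxVK g) c0 cE _ s0).
congr cintegral; apply/funext => x.
by rewrite undilateE -mulrA -dot_mulmx GL_mulKmx.
Qed.

(** Undilating an approximating sequence of f approximates the undilated f, while its integral
    transforms become those of the original sequence composed with g^-T and rescaled, which again
    converge in L^2. *)
Lemma is_fourier_undilate g : exists2 t : R, 0 < t & forall f f',
  is_fourier f f' -> is_fourier (undilate g f)
    (fun gamma => t%:C * f' ((GL_val g^-1%g)^T *m gamma)).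
Proof.
have [t t0 tE] := fourier1_undilate g.
have uT : (GL_val g^-1%g)^T \in unitmx by rewrite unitmx_tr; exact: GL_valP.
have [c c0 cE] := lebesgue_Rn_mulmx uT.
exists t => // f f' [Lf Lf' [u [Lu uf uf']]]; split.
- exact: Lp_undilate.
- exact: (Lp_change_of_variables (measurable_mulmx _)
    (measurable_mulmx _) (mulmxTK g) (mulmxTVK g) c0 cE t0).
- exists (fun k => undilate g (u k)); split.
  + by move=> k; have [? ?] := Lu k; split; exact: Lp_undilate.
  + exact: cvg_Lp_undilate.
  + rewrite (_ : (fun k => _) = fun k gamma =>
        t%:C * fourier1 (u k) ((GL_val g^-1%g)^T *m gamma)).
      exact: (cvg_Lp_change_of_variables (measurable_mulmx _)
        (measurable_mulmx _) (mulmxTK g) (mulmxTVK g) c0 cE t0 _ uf').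
    by apply/funext => k; apply/funext => gamma; rewrite tE.
Qed.

(** Composition with g^-T moves the vanishing outside [U] to vanishing outside g^T U, up to a null
    set. *)
Lemma HU_undilate g U f : HU U f ->
  HU [set (GL_val g)^T *m u | u in U] (undilate g f).
Proof.
move=> [Lf [f' ff' f'0]]; split; first exact: Lp_undilate.
have [t t0 tE] := is_fourier_undilate g.
exists (fun gamma => t%:C * f' ((GL_val g^-1%g)^T *m gamma)); first exact: tE.
have uT : (GL_val g^-1%g)^T \in unitmx by rewrite unitmx_tr; exact: GL_valP.
have [c c0 cE] := lebesgue_Rn_mulmx uT.
have := ae_change_of_variables (measurable_mulmx _) cE f'0.
apply: filterS => gamma H nU; rewrite H ?mulr0// => Ug; apply: nU.
by exists ((GL_val g^-1%g)^T *m gamma) => //; exact: GL_trmulKmx.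
Qed.

Lemma image_trmulK g U :
  [set (GL_val g^-1%g)^T *m u | u in [set (GL_val g)^T *m u | u in U]] = U.
Proof.
apply/seteqP; split=> [_ [_ [u Uu <-] <-]|u Uu].
  by rewrite GL_trmulVKmx.
exists ((GL_val g)^T *m u); last by rewrite GL_trmulVKmx.
by exists u.
Qed.

Lemma HU_undilateV g U f : HU [set (GL_val g)^T *m u | u in U] f ->
  HU U (undilate g^-1%g f).
Proof. by move=> /(HU_undilate g^-1%g); rewrite image_trmulK. Qed.

(** Write f as the undilation of [undilate g^-1 f] and move the group element through by
    intertwining; both arguments of the inner product are then undilated. *)
Lemma voice_undilate g : exists2 k : R, 0 < k & forall psi f a,
  voice (undilate g psi) f a =
  k%:C * voice psi (undilate g^-1%g f) (dil_conj g^-1%g a).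
Proof.
have [k k0 kE] := inner_undilate g.
exists k => // psi f a; rewrite /voice -kE undilateVK.
by rewrite -qreg_undilate dil_conjVK.
Qed.

End dilation.

(** * Transfer of admissibility, irreducibility and discrete series *)

Section transfer.
Local Open Scope complex_scope.
Context (R : realType) (n : nat).
Local Notation V := 'cV[R]_n.
Local Notation leb := (lebesgue_Rn R n).
Variables (g : GL R n) (G : set (aWH R n)) (U : set V).
Local Notation gTU := [set (GL_val g)^T *m u | u in U].
Local Notation G' := (conjugate_by (dil g) G).
Local Notation mconj := (@measurable_dil_conj R n).

Lemma preimage_dil_conj (A : set (aWH R n)) :
  dil_conj g @^-1` (dil_conj g^-1%g @^-1` A) = A.
Proof. by apply/seteqP; split=> a /=; rewrite dil_conjK. Qed.

(** This puts the transported Haar measure in the form required by the change of variables, with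
    scaling factor 1. *)
Lemma pushforward_dil_conjE (mu : {measure set (borel (aWH R n)) -> \bar R})
    (A : set (borel (aWH R n))) :
  measurable A ->
  pushforward_measure mu (mconj g) (dil_conj g^-1%g @^-1` A) = (1%:E * mu A)%E.
Proof.
by move=> mA; rewrite /= /pushforward mul1e preimage_dil_conj.
Qed.

Lemma cLnorm_dil_conj (mu : {measure set (borel (aWH R n)) -> \bar R})
    (F : aWH R n -> R[i]) (s : R) : 0 < s ->
  cLnorm (pushforward_measure mu (mconj g)) 2%:E
    (fun a => s%:C * F (dil_conj g^-1%g a)) = (s%:E * cLnorm mu 2%:E F)%E.
Proof.
move=> s0; rewrite (cLnorm_change_of_variables (mconj g^-1%g)
  (mconj g) (dil_conjVK g) (dil_conjK g) ltr01 (pushforward_dil_conjE mu))//.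
by rewrite mulr1 -powRrM mulfV// powRr1 ?ltW.
Qed.

Lemma Lp_dil_conj (mu : {measure set (borel (aWH R n)) -> \bar R})
    (F : aWH R n -> R[i]) (s : R) : 0 < s -> Lp mu 2%:E F ->
  Lp (pushforward_measure mu (mconj g)) 2%:E
    (fun a => s%:C * F (dil_conj g^-1%g a)).
Proof.
move=> s0; exact: (Lp_change_of_variables (mconj g^-1%g)
  (mconj g) (dil_conjVK g) (dil_conjK g) ltr01 (pushforward_dil_conjE mu)).
Qed.

Lemma admissible_conjugate psi :
  admissible G U psi -> admissible G' gTU (undilate g psi).
Proof.
move=> [Hpsi [mu Gmu [c [W [c0 [LW isoW] WE]]]]].
split; first exact: HU_undilate.
exists (pushforward_measure mu (mconj g)); first exact: left_haar_dil_conj.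
have [l l0 lE] := cLnorm_undilate g^-1%g.
have [k k0 kE] := voice_undilate g.
have l'0 : 0 < l^-1 by rewrite invr_gt0.
(* The inverse undilation multiplies norms by l, so dividing the transported [W] by l restores the
   isometry; l reappears in the scalar beside the factor k of the voice transform. *)
exists (k%:C * (l%:C * c)),
  (fun f a => (l^-1)%:C * W (undilate g^-1%g f) (dil_conj g^-1%g a)); split.
- by rewrite !mulf_neq0// fmorph_eq0 gt_eqF.
- split=> [f Uf|f1 f2 Uf1 Uf2].
    by apply: Lp_dil_conj => //; exact/LW/HU_undilateV.
  pose F a := W (undilate g^-1%g f1) a - W (undilate g^-1%g f2) a.
  transitivity (cLnorm (pushforward_measure mu (mconj g)) 2%:E
    (fun a => (l^-1)%:C * F (dil_conj g^-1%g a))).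
    by congr cLnorm; apply/funext => a; rewrite mulrBr.
  rewrite cLnorm_dil_conj// isoW; [|exact: HU_undilateV|exact: HU_undilateV].
  by rewrite -undilateB lE muleA -EFinM mulVf ?mul1e// gt_eqF.
- move=> f Uf a; rewrite conjugate_byE => Ga.
  rewrite kE (WE _ (HU_undilateV Uf) _ Ga).
  rewrite -!mulrA; congr (_ * _); rewrite mulrCA; congr (_ * _).
  by rewrite mulrA -rmorphM/= mulfV ?mul1r// gt_eqF.
Qed.

Lemma weakly_admissible_conjugate psi :
  weakly_admissible G U psi -> weakly_admissible G' gTU (undilate g psi).
Proof.
move=> [Hpsi [mu Gmu [[C HC] inj]]].
split; first exact: HU_undilate.
exists (pushforward_measure mu (mconj g)); first exact: left_haar_dil_conj.
have [l l0 lE] := cLnorm_undilate g^-1%g.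
have [k k0 kE] := voice_undilate g.
split.
  (* Here k comes from the voice transform, [C] from the old bound, and l from the norm of the
     undilated f. *)
  exists (k * (C * l)) => f Uf; have [Lf fC] := HC _ (HU_undilateV Uf).
  have -> : voice (undilate g psi) f = fun a =>
      k%:C * voice psi (undilate g^-1%g f) (dil_conj g^-1%g a).
    by apply/funext => a; rewrite kE.
  split; first exact: Lp_dil_conj.
  by rewrite cLnorm_dil_conj// 2!EFinM -!muleA -lE lee_pmul2l.
move=> f1 f2 Uf1 Uf2 f12.
rewrite -[f1](undilateVK g) -[f2](undilateVK g); apply: ae_undilate.
apply: inj; [exact: HU_undilateV|exact: HU_undilateV|].
(* The almost everywhere equality is pulled back to [mu]; there it concerns the original voice
   transforms of the undilated functions, up to the nonzero factor k. *)
have muE (A : set (borel (aWH R n))) : measurable A -> mu (dil_conj g @^-1` A) =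
    (1%:E * pushforward_measure mu (mconj g) A)%E by move=> _; rewrite mul1e.
have := ae_change_of_variables (mconj g) muE f12.
apply: filterS => a /=; rewrite !kE dil_conjK; apply: mulfI.
by rewrite fmorph_eq0 gt_eqF.
Qed.

Lemma irreducible_conjugate :
  irreducible_on G (HU U) -> irreducible_on G' (HU gTU).
Proof.
move=> [[f Uf fN0] irr]; split.
  exists (undilate g f); first exact: HU_undilate.
  move=> Df0; apply: fN0; rewrite -[f](undilateK g).
  exact: ae_undilate_eq0.
move=> K [KL K0 KD Kcl] KU KG.
(* Pulling [K] back along the intertwiner gives a closed invariant subspace for the original action,
   to which irreducibility applies. *)
pose K' := [set f | K (undilate g f)].
have K'L : K' `<=` Lp leb 2%:E.
  move=> h /KL Lh; rewrite -[h](undilateK g); exact: Lp_undilate.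
have clK' : closed_subspace leb K'.
  split=> //.
  - by rewrite /K'/= undilate0.
  - by move=> a f1 f2 Kf1 Kf2; rewrite /K'/= undilateD; exact: KD.
  - move=> u h Ku Lh uh; apply: (Kcl (fun k => undilate g (u k))) => //.
      exact: Lp_undilate.
    exact: cvg_Lp_undilate.
have K'U : K' `<=` HU U.
  move=> h /KU; rewrite -{2}[h](undilateK g); exact: HU_undilateV.
have K'G a h : G a -> K' h -> K' (qreg a h).
  move=> Ga Kh; rewrite /K'/= -qreg_undilate; apply: KG => //.
  by rewrite conjugate_byE /= dil_conjK.
have [H|H] := irr _ clK' K'U K'G; [left|right] => h Kh.
  rewrite -[h](undilateVK g); apply: ae_undilate_eq0.
  by apply: H; rewrite /K'/= undilateVK.
by rewrite -[h](undilateVK g); apply: H; exact: HU_undilateV.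
Qed.

Lemma discrete_series_conjugate :
  discrete_series G U -> discrete_series G' gTU.
Proof.
move=> [irr [psi Hpsi]]; split; first exact: irreducible_conjugate.
by exists (undilate g psi); exact: admissible_conjugate.
Qed.

End transfer.

(** * Conjugate translation complete subgroups and coordinate subspaces *)

Section subgroups.
Context (R : realType) (n : nat).
Local Notation V := 'cV[R]_n.
Implicit Types (g h : GL R n) (W : {vspace V}) (H : set (GL R n)).
Local Notation trimg g W := (linfun (mulmx (GL_val g)^T) @: W)%VS.

Lemma mem_trimg g W (v : V) :
  (v \in trimg g W) = ((GL_val g^-1%g)^T *m v \in W).
Proof.
apply/memv_imgP/idP => [[u Wu ->]|Wv]; first by rewrite lfunE/= GL_trmulVKmx.
by exists ((GL_val g^-1%g)^T *m v) => //; rewrite lfunE/= GL_trmulKmx.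
Qed.

Lemma conjugate_by_inE (G : groupType) (x : G) (S : set G) (y : G) :
  conjugate_by x S y <-> S (x * y * x^-1)%g.
Proof.
split=> [[a Sa <-]|Sy]; first by rewrite !mulgA mulgV mul1g mulgK.
by exists (x * y * x^-1)%g => //; rewrite !mulgA mulVg mul1g mulgVK.
Qed.

Lemma tc_set_conjugate_dil g W H :
  conjugate_by (dil g) (tc_set W H) = tc_set (trimg g W) (conjugate_by g H).
Proof.
apply/seteqP; split=> [_ [[[[z x] xi] h] [/= Wxi Hh] <-]|].
  rewrite -[X in tc_set _ _ X]/(dil_conj g (AWH z x xi h)) dil_conjE.
  by split=> /=; [rewrite mem_trimg GL_trmulVKmx|exists h].
move=> [[[z x] xi] h] [/= Wxi [h1 Hh1 h1h]].
exists (AWH z (g *m x) ((GL_val g^-1%g)^T *m xi) h1).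
  by split => //=; rewrite -mem_trimg.
rewrite -[LHS]/(dil_conj g _) dil_conjE.
by rewrite GL_mulKmx GL_trmulKmx h1h.
Qed.

Lemma conjugate_tc_set (x : aWH R n) W1 W2 H1 H2 :
  is_subgroup H1 -> is_subgroup H2 ->
  conjugate_by x (tc_set W1 H1) = tc_set W2 H2 ->
  W2 = trimg x.2 W1 /\ H2 = conjugate_by x.2 H1.
Proof.
move: x => [[[z0 x0] xi0] g] [H11 _ _] [H21 _ _] /= E.
have conjE z y xi h :
    ((AWH z0 x0 xi0 g)^-1 * AWH z y xi h * AWH z0 x0 xi0 g)%g.2
    = (g^-1 * h * g)%g by [].
(* For trivial dilation part, the two contributions of [xi0] cancel. *)
have conj1 z y xi :
    ((AWH z0 x0 xi0 g)^-1 * AWH z y xi 1%g * AWH z0 x0 xi0 g)%g.1.2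
    = (GL_val g)^T *m xi.
  transitivity (- ((GL_val g)^T *m xi0) + invT g^-1%g *m xi +
    invT (g^-1 * 1)%g *m xi0) => //.
  by rewrite mulg1 /invT invgK addrAC addNr add0r.
split.
  (* Both inclusions use elements with dilation part 1, which lie in the groups because [H1] and
     [H2] contain 1; a conjugate has dilation part 1 only if the original does. *)
  apply/vspaceP => v; apply/idP/idP => [W2v|].
    have : tc_set W2 H2 (AWH 1%g 0 v 1%g) by split.
    rewrite -E => -[[[[z y] xi] h] [/= W1xi _] a].
    have := congr1 (fun b => b.2) a; rewrite conjE /= => h1.
    have {}h1 : h = 1%g.
      by rewrite -[h](mulVKg g) -[(g^-1 * h)%g](mulgK g) h1 mul1g mulgV.
    have := congr1 (fun b => b.1.2) a; rewrite h1 conj1 /= => <-.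
    by rewrite mem_trimg GL_trmulVKmx.
  rewrite mem_trimg => W1v.
  have : tc_set W2 H2 ((AWH z0 x0 xi0 g)^-1 *
      AWH 1%g 0 ((GL_val g^-1%g)^T *m v) 1%g * AWH z0 x0 xi0 g)%g.
    by rewrite -E; exists (AWH 1%g 0 ((GL_val g^-1%g)^T *m v) 1%g).
  by move=> [+ _]; rewrite conj1 GL_trmulKmx.
apply/seteqP; split=> [h H2h|_ [h H1h <-]].
  have : tc_set W2 H2 (AWH 1%g 0 0 h) by split=> //=; exact: mem0v.
  rewrite -E => -[[[[z y] xi] h1] [_ /= H1h] a].
  by exists h1 => //; have := congr1 (fun b => b.2) a; rewrite conjE.
have : tc_set W2 H2 ((AWH z0 x0 xi0 g)^-1 * AWH 1%g 0 0 h * AWH z0 x0 xi0 g)%g.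
  by rewrite -E; exists (AWH 1%g 0 0 h) => //; split=> //=; exact: mem0v.
by move=> [_]; rewrite conjE.
Qed.

Lemma is_subgroup_conjugate (G : groupType) (x : G) (S : set G) :
  is_subgroup S -> is_subgroup (conjugate_by x S).
Proof.
move=> [S1 SM SV]; split.
- by exists 1%g => //; rewrite mulg1 mulVg.
- move=> _ _ [a Sa <-] [b Sb <-]; exists (a * b)%g; first exact: SM.
  by rewrite !mulgA mulgK.
- move=> _ [a Sa <-]; exists a^-1%g; first exact: SV.
  by rewrite !invgM invgK mulgA.
Qed.

(** The transpose of g^-1 h g is g^T h^T g^-T, whose last factor cancels the g^T in front of u -
    v. *)
Lemma dual_act_conjugate g h (u v : V) :
  dual_act ((GL_val g)^T *m u) ((GL_val g)^T *m v) (g^-1 * h * g)%g =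
  (GL_val g)^T *m dual_act u v h.
Proof.
rewrite /dual_act !GL_valM !trmx_mul -mulmxBr -!mulmxA.
by rewrite GL_trmulVKmx.
Qed.

Lemma translation_complete_conjugate g W H :
  translation_complete W H ->
  translation_complete (trimg g W) (conjugate_by g H).
Proof.
move=> [sH cH HW sG]; split.
- exact: is_subgroup_conjugate.
- rewrite (_ : conjugate_by g H =
    (fun h : GL R n => (g^-1^-1 * h * g^-1)%g) @^-1` H).
    apply: (continuous_closedP _).1 => //; exact: GL_conj_continuous.
  by apply/seteqP; split=> h /=; rewrite invgK => /conjugate_by_inE.
- move=> _ [h Hh <-] v /memv_imgP[u Wu ->]; rewrite lfunE/=.
  (* At frequency 0 the dual action is multiplication by h^T, so equivariance yields stability of
     the subspace. *)
  have := dual_act_conjugate g h u 0; rewrite /dual_act mulmx0 !subr0 => ->.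
  by rewrite mem_trimg GL_trmulVKmx HW.
- by rewrite -tc_set_conjugate_dil; exact: is_subgroup_conjugate.
Qed.

Lemma dual_invariant_conjugate g W H U : dual_invariant W H U ->
  dual_invariant (trimg g W) (conjugate_by g H)
    [set (GL_val g)^T *m u | u in U].
Proof.
move=> inv _ _ _ [u Uu <-] /memv_imgP[v Wv ->] [h Hh <-].
rewrite lfunE/= dual_act_conjugate.
by exists (dual_act u v h) => //; exact: inv.
Qed.

Lemma measurable_trmul g (U : set V) : measurable (U : set (borel V)) ->
  measurable ([set (GL_val g)^T *m u | u in U] : set (borel V)).
Proof.
move=> mU; rewrite (_ : [set _ | _ in _] = mulmx (GL_val g^-1%g)^T @^-1` U).
  by rewrite -[X in measurable X]setTI; exact: measurable_mulmx.
apply/seteqP; split=> [_ [u Uu <-]|v /= Uv]; first by rewrite /= GL_trmulVKmx.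
by exists ((GL_val g^-1%g)^T *m v) => //; rewrite GL_trmulKmx.
Qed.

Lemma mem_coord_subspace k (v : V) :
  reflect (forall i : 'I_n, (k <= i)%N -> v i 0 = 0)
    (v \in coord_subspace R n k).
Proof.
apply: (iffP idP) => [/memv_sumP[vs vsP ->] i ki|v0].
  rewrite summxE big1// => j jk; have /vlineP[a ->] := vsP j jk.
  rewrite !mxE; case: eqP => [ij|_]; last by rewrite mulr0.
  by rewrite -ij ltnNge ki in jk.
have -> : v = \sum_(i < n | (i < k)%N) v i 0 *: delta_mx i 0.
  rewrite [LHS]matrix_sum_delta (bigID (fun i : 'I_n => (i < k)%N))/=.
  rewrite [X in _ + X]big1 ?addr0 => [|i]; last first.
    by rewrite -leqNgt => ki; rewrite big_ord1 v0// scale0r.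
  by apply: eq_bigr => i _; rewrite big_ord1.
rewrite memv_sumr// => i ik; exact: memvZ (memv_line _).
Qed.

(* [g] is the inverse of [row_ebase] of the matrix whose rows form a basis of
   [W]. *)
Lemma exists_trimg_coord W : exists g : GL R n,
  trimg g W = coord_subspace R n (\dim W).
Proof.
set k := \dim W.
pose B : 'M[R]_(k, n) := \matrix_(i, j) (vbasis W)`_i j 0.
have BE (c : 'rV_k) : (c *m B)^T = \sum_(i < k) c 0 i *: (vbasis W)`_i.
  apply/colP => j; rewrite !mxE summxE; apply: eq_bigr => i _.
  by rewrite !mxE.
have rB : \rank B = k.
  apply/eqP; apply: inj_row_free => c cB.
  have /freeP fr := basis_free (vbasisP W).
  apply/rowP => i; rewrite mxE; apply: (fr (fun i => c 0 i)).
  by rewrite -BE cB trmx0.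
have BW (c : 'rV_k) : (c *m B)^T \in W.
  by rewrite BE; apply: memv_suml => i _; apply/memvZ/vbasis_mem/mem_nth;
     rewrite size_tuple.
have WB (v : V) : v \in W -> exists c, v = (c *m B)^T.
  move=> Wv; exists (\row_i coord (vbasis W) i v).
  by rewrite BE {1}(coord_vbasis Wv); apply: eq_bigr => i _; rewrite mxE.
have Bdef : B = col_ebase B *m pid_mx k *m row_ebase B.
  by rewrite -{1}(mulmx_ebase B) rB.
have uE := row_ebase_unit B; have uC := col_ebase_unit B.
have uE' : invmx (row_ebase B) \in unitmx by rewrite unitmx_inv.
(* Multiplying by g^T on columns is multiplying by the inverse of [row_ebase B] on rows; what
   remains ends in [pid_mx k], so all entries past the first k vanish. *)
have BE' : B *m invmx (row_ebase B) = col_ebase B *m pid_mx k.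
  by rewrite [X in X *m _]Bdef mulmxK.
exists (GLof uE'); apply/vspaceP => v; apply/idP/mem_coord_subspace.
  move=> /memv_imgP[w /WB[c ->] ->] i ki; rewrite lfunE/= -trmx_mul mxE.
  rewrite -mulmxA BE' mulmxA mxE.
  apply: big1 => j _.
  by rewrite [pid_mx _ _ _]mxE (ltn_eqF (leq_trans (ltn_ord j) ki)) mulr0.
(* [d] holds the first k coordinates of v; padding it with zeros recovers v because the others
   vanish. *)
move=> v0; pose d := v^T *m @pid_mx R n k k.
have vE : d *m @pid_mx R k n k = v^T.
  rewrite -mulmxA mul_pid_mx !minnn.
  apply/rowP => i; rewrite !mxE (bigD1 i)//= big1 ?addr0 => [|j ji].
    rewrite !mxE eqxx/=; case: ltnP => [_|ki]; first by rewrite mulr1.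
    by rewrite v0// mul0r.
  by rewrite !mxE (val_eqE j i) (negbTE ji) mulr0.
clearbody d; apply/memv_imgP.
(* The factor [invmx (col_ebase B)] cancels the [col_ebase B] left in [BE'], so the image is the
   padded [d]. *)
exists ((d *m invmx (col_ebase B)) *m B)^T; first exact: BW.
rewrite lfunE/= -trmx_mul -!mulmxA BE' [invmx _ *m _]mulmxA mulVmx// mul1mx.
by rewrite vE trmxK.
Qed.

End subgroups.

Theorem lemma6p1 (R : realType) (n : nat) :
  (forall (V1 V2 : {vspace 'cV[R]_n}) (H1 H2 : set (GL R n)),
     translation_complete V1 H1 -> translation_complete V2 H2 ->
     (* (a) *)
     ((conjugate (tc_set V1 H1) (tc_set V2 H2) <->
       exists g : GL R n,
         conjugate_by (dil g) (tc_set V1 H1) = tc_set V2 H2) /\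
      (forall g : GL R n,
         conjugate_by (dil g) (tc_set V1 H1) = tc_set V2 H2 <->
         V2 = (linfun (mulmx (GL_val g)^T) @: V1)%VS /\
         H2 = conjugate_by g H1)) /\
     (* (b) *)
     (forall g : GL R n,
        conjugate_by (dil g) (tc_set V1 H1) = tc_set V2 H2 ->
        forall U : set 'cV[R]_n,
        measurable (U : set (borel 'cV[R]_n)) -> dual_invariant V1 H1 U ->
        let gTU := [set (GL_val g)^T *m u | u in U] in
        [/\ measurable (gTU : set (borel 'cV[R]_n)) /\
            dual_invariant V2 H2 gTU,
            forall psi : 'cV[R]_n -> R[i],
              admissible (tc_set V1 H1) U psi ->
              admissible (tc_set V2 H2) gTU (qreg (dil g)^-1%g psi),
            forall psi : 'cV[R]_n -> R[i],
              weakly_admissible (tc_set V1 H1) U psi ->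
              weakly_admissible (tc_set V2 H2) gTU (qreg (dil g)^-1%g psi) &
            discrete_series (tc_set V1 H1) U <->
            discrete_series (tc_set V2 H2) gTU])) /\
  (* (c) *)
  (forall (V : {vspace 'cV[R]_n}) (H : set (GL R n)),
     translation_complete V H ->
     exists H' : set (GL R n),
       translation_complete (coord_subspace R n (\dim V)) H' /\
       conjugate (tc_set V H) (tc_set (coord_subspace R n (\dim V)) H')).
Proof.
split=> [V1 V2 H1 H2 [sH1 _ _ _] [sH2 _ _ _]|V H tcVH]; last first.
  have [g gE] := exists_trimg_coord V.
  exists (conjugate_by g H); rewrite -gE; split.
    exact: translation_complete_conjugate.
  by exists (dil g); exact: tc_set_conjugate_dil.
have dilP (g : GL R n) : conjugate_by (dil g) (tc_set V1 H1) = tc_set V2 H2 <->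
    V2 = (linfun (mulmx (GL_val g)^T) @: V1)%VS /\ H2 = conjugate_by g H1.
  split=> [|[-> ->]]; last exact: tc_set_conjugate_dil.
  exact: (@conjugate_tc_set _ _ (dil g)).
split; first split=> //.
  split=> [[x /conjugate_tc_set xE]|[g gE]]; last by exists (dil g).
  (* The two equalities extracted from the conjugation involve only the dilation part of the
     conjugating element. *)
  by exists x.2; apply/dilP; exact: xE.
move=> g gE U mU invU gTU.
have [V2E H2E] := (dilP g).1 gE.
split.
- split; first exact: measurable_trmul.
  by rewrite V2E H2E; exact: dual_invariant_conjugate.
- by move=> psi; rewrite -gE; exact: admissible_conjugate.
- by move=> psi; rewrite -gE; exact: weakly_admissible_conjugate.
- rewrite -gE; split; first exact: discrete_series_conjugate.
  (* The converse is the transfer along g^-1, which takes the set and the group back to the original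
     ones. *)
  move=> /(discrete_series_conjugate g^-1%g).
  by rewrite image_trmulK -dilV conjugate_byK.
Qed.
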